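(* There is a one-dimensional Lévy operator $L$ and a smooth function $h$ on $\mathbb{R}$ with the following properties: (a) $L$ is not concentrated on a proper closed subgroup of $\mathbb{R}$; (b) for every $\varepsilon>0$ we have $\lim_{|x|\to\infty}|x|^{-\varepsilon}h(x)=0$; (c) $Lh(x)=0$ for every $x\in\mathbb{R}$ (so that, in particular, the integral in the definition of $Lh(x)$ is absolutely convergent); (d) $h$ is $L$-harmonic in the sense of tempered distributions: the $\mathscr{S}'$-convolution $\check L\circledast h$ is well-defined and equal to zero, where $\check L$ is the convolution kernel of $L$; but $h$ is not a polynomial.
   Context: $\mathscr{S}$ is the Schwartz class on $\mathbb{R}$, $\mathscr{S}'$ the space of tempered distributions. One-dimensional Lévy operator: an operator of the form $$Lf(x)=a f''(x)+b f'(x)+\int_{\mathbb{R}\setminus\{0\}}\bigl(f(x+y)-f(x)-\mathbf{1}_{B}(y)\,y f'(x)\bigr)\nu(dy),$$ where $B$ is the unit ball (interval), $a\ge0$, $b\in\mathbb{R}$, and $\nu$ is a nonnegative measure on $\mathbb{R}\setminus\{0\}$ with $\int\min\{1,y^2\}\,\nu(dy)<\infty$. Its characteristic exponent is $\Psi(\xi)=a\xi^2-ib\xi+\int_{\mathbb{R}\setminus\{0\}}(1-e^{i\xi y}+i\xi y\mathbf{1}_{B}(y))\,\nu(dy)$. $L$ is not concentrated on a proper closed subgroup of $\mathbb{R}$ if $\Psi(\xi)=0$ only for $\xi=0$. The convolution kernel $\check L$ of $L$ is the tempered distribution defined by $\langle\check L,\varphi\rangle=L^\dagger\varphi(0)$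 for $\varphi\in\mathscr{S}$, where $L^\dagger$ is the Lévy operator with parameters $a$, $-b$, $\nu^\dagger(A)=\nu(-A)$; thus $\check L*\varphi=L\varphi$ for $\varphi\in\mathscr{S}$. The $\mathscr{S}'$-convolution of $f,g\in\mathscr{S}'$ is well-defined if there is a tempered distribution $f\circledast g$ such that $(f\circledast g)*(\varphi*\psi)=(f*\varphi)*(g*\psi)$ for every $\varphi,\psi\in\mathscr{S}$, where the convolution of the functions $f*\varphi$ and $g*\psi$ is assumed to exist in the usual sense (absolutely convergent integral). *)

(* Defs.v *)
From HB Require Import structures.
From mathcomp Require Import all_boot all_order all_algebra.
From mathcomp Require Import complex.
From mathcomp Require Import all_classical all_reals all_analysis.
From mathcomp Require Import measurable_realfun.

Set Implicit Arguments.
Unset Strict Implicit.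
Unset Printing Implicit Defensive.

Import Order.TTheory GRing.Theory Num.Theory.
Import numFieldNormedType.Exports.

Local Open Scope classical_set_scope.
Local Open Scope ring_scope.

(* MathComp-Analysis has neither derivatives nor integrals of functions with
   values in R[i]: both are taken componentwise. *)
Section ComplexValued.
Context {R : realType}.
Implicit Types (u : R -> R) (f g : R -> R[i]).

Definition smooth u : Prop := forall n x, derivable (u^`(n)%classic) x 1.

Definition re_part f : R -> R := fun x => complex.Re (f x).
Definition im_part f : R -> R := fun x => complex.Im (f x).

Definition of_real u : R -> R[i] := fun x => (u x)%:C%C.

Definition csmooth f : Prop := smooth (re_part f) /\ smooth (im_part f).

Definition cderiven (n : nat) f : R -> R[i] :=
  fun x => ((re_part f)^`(n)%classic x +i* (im_part f)^`(n)%classic x)%C.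

Definition cintegrable (mu : {measure set (measurableTypeR R) -> \bar R})
    (D : set R) f : Prop :=
  mu.-integrable D (EFin \o re_part f) /\ mu.-integrable D (EFin \o im_part f).

Definition cintegral (mu : {measure set (measurableTypeR R) -> \bar R})
    (D : set R) f : R[i] :=
  (Rintegral mu D (re_part f) +i* Rintegral mu D (im_part f))%C.

(* exp (i t) *)
Definition cexpi (t : R) : R[i] := (cos t +i* sin t)%C.

(* Junk value unless [convolvable f g x]. *)
Definition convolution f g : R -> R[i] :=
  fun x => cintegral lebesgue_measure setT (fun y => f (x - y) * g y).

Definition convolvable f g (x : R) : Prop :=
  cintegrable lebesgue_measure setT (fun y => f (x - y) * g y).

End ComplexValued.

Definition oppT (R : realType) : measurableTypeR R -> measurableTypeR R :=
  fun y : R => - y.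

Lemma measurable_oppT (R : realType) : measurable_fun setT (@oppT R).
Proof. exact: oppr_measurable. Qed.

Section ReflectMeasure.
Context {R : realType} (nu : {measure set (measurableTypeR R) -> \bar R}).

Definition reflect_measure : set (measurableTypeR R) -> \bar R :=
  pushforward nu (@oppT R).

HB.instance Definition _ := Measure.copy reflect_measure
  (measure_function_pushforward__canonical__measure_function_Measure
     nu (@measurable_oppT R)).

End ReflectMeasure.

Section Levy.
Context {R : realType}.
Implicit Types (u : R -> R) (f : R -> R[i]).

(* A measure on R \ {0} is represented by a Borel measure on R without mass at
   the origin. *)
Record levy_operator := LevyOperator {
  levy_a : R ;
  levy_b : R ;
  levy_nu : {measure set (measurableTypeR R) -> \bar R} ;
  levy_a_ge0 : 0 <= levy_a ;
  levy_nu0 : levy_nu [set 0] = 0%E ;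
  levy_nu_fin :
    (\int[levy_nu]_(y in [set~ 0%R]) (Num.min 1 (y ^+ 2))%:E < +oo)%E
}.

Definition levy_integrand u (x y : R) : R :=
  u (x + y) - u x - \1_(ball (0 : R) 1) y * y * u^`()%classic x.

(* Junk value unless the integrand is integrable. *)
Definition levy_apply (L : levy_operator) u (x : R) : R :=
  levy_a L * u^`(2)%classic x + levy_b L * u^`()%classic x
  + Rintegral (levy_nu L) [set~ 0] (levy_integrand u x).

Definition levy_capply (L : levy_operator) f (x : R) : R[i] :=
  (levy_apply L (re_part f) x +i* levy_apply L (im_part f) x)%C.

Definition levy_exponent (L : levy_operator) (xi : R) : R[i] :=
  (levy_a L * xi ^+ 2)%:C%C - 'i%C * (levy_b L * xi)%:C%C
  + cintegral (levy_nu L) [set~ 0]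
      (fun y => 1 - cexpi (xi * y)
                + 'i%C * (xi * y * \1_(ball (0 : R) 1) y)%:C%C).

Definition not_concentrated_on_proper_closed_subgroup (L : levy_operator) :
    Prop :=
  forall xi, levy_exponent L xi = 0 -> xi = 0.

Lemma preimage_oppT_setC10 : @oppT R @^-1` [set~ 0] = [set~ 0].
Proof.
apply/seteqP; split => y /=; rewrite /oppT.
- by apply: contra_not => ->; rewrite oppr0.
- by apply: contra_not => /eqP; rewrite oppr_eq0 => /eqP.
Qed.

Lemma reflect_measure0 (L : levy_operator) :
  reflect_measure (levy_nu L) [set 0] = 0%E.
Proof.
rewrite /reflect_measure /pushforward -[RHS](levy_nu0 L); congr (levy_nu L _).
apply/seteqP; split => y /=; rewrite /oppT.
- by move/eqP; rewrite oppr_eq0 => /eqP.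
- by move=> ->; rewrite oppr0.
Qed.

Lemma reflect_measure_fin (L : levy_operator) :
  (\int[reflect_measure (levy_nu L)]_(y in [set~ 0%R])
     (Num.min 1 (y ^+ 2))%:E < +oo)%E.
Proof.
rewrite /reflect_measure ge0_integral_pushforward//=.
- rewrite preimage_oppT_setC10.
  under eq_integral do rewrite /= /oppT sqrrN.
  exact: levy_nu_fin.
- exact: measurable_oppT.
- by apply: measurableC; exact: measurable_set1.
- by apply/measurable_EFinP; exact: measurable_minr.
- by move=> y _; rewrite lee_fin le_min ler01 sqr_ge0.
Qed.

Definition levy_dual (L : levy_operator) : levy_operator :=
  @LevyOperator (levy_a L) (- levy_b L) (reflect_measure (levy_nu L))
    (levy_a_ge0 L) (reflect_measure0 L) (reflect_measure_fin L).

Definition levy_kernel (L : levy_operator) : (R -> R[i]) -> R[i] :=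
  fun phi => levy_capply (levy_dual L) phi 0.

End Levy.
Arguments levy_operator : clear implicits.

Section TemperedDistributions.
Context {R : realType}.
Implicit Types (phi psi f : R -> R[i]) (T F G : (R -> R[i]) -> R[i]).

Definition schwartz_values (m n : nat) phi : set R :=
  [set `|x| ^+ m * ComplexField.Normc.normc (cderiven n phi x) | x in setT].

Definition schwartz phi : Prop :=
  csmooth phi /\ forall m n, has_ubound (schwartz_values m n phi).

Definition schwartz_seminorm (m n : nat) phi : R :=
  sup (schwartz_values m n phi).

(* A functional on the Schwartz class is given by a map on all functions, of
   which only the values on Schwartz functions are relevant. Continuity is with
   respect to the topology defined by the family of seminorms above. *)
Definition tempered T : Prop :=
  (forall (c : R[i]) phi psi, schwartz phi -> schwartz psi ->
     T (fun x => c * phi x + psi x) = c * T phi + T psi) /\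
  (exists (C : R) (N : nat), forall phi, schwartz phi ->
     ComplexField.Normc.normc (T phi) <=
       C * \sum_(m < N) \sum_(n < N) schwartz_seminorm m n phi).

Definition distribution_of f : (R -> R[i]) -> R[i] :=
  fun phi => cintegral lebesgue_measure setT (fun x => f x * phi x).

Definition dconvolution T phi : R -> R[i] := fun x => T (fun y => phi (x - y)).

(* [T] is the S'-convolution of [F] and [G]. *)
Definition is_Sprime_convolution F G T : Prop :=
  [/\ tempered F, tempered G, tempered T &
    forall phi psi, schwartz phi -> schwartz psi -> forall x,
      convolvable (dconvolution F phi) (dconvolution G psi) x /\
      dconvolution T (convolution phi psi) x =
        convolution (dconvolution F phi) (dconvolution G psi) x].

End TemperedDistributions.

(* Main.v *)
Require Import Defs.
From HB Require Import structures.
From mathcomp Require Import all_boot all_order all_algebra.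
From mathcomp Require Import complex.
From mathcomp Require Import all_classical all_reals all_analysis.
From mathcomp Require Import measurable_realfun.
From mathcomp Require Import ring lra zify.
Import Order.TTheory GRing.Theory Num.Theory.
Import numFieldNormedType.Exports.
Set Implicit Arguments.
Unset Strict Implicit.
Unset Printing Implicit Defensive.
Local Open Scope classical_set_scope.
Local Open Scope ring_scope.

(** The operator is the generator of a pure-jump process with a purely atomic
    jump law, [L f (x) = sum_k w_k (f (x + y_k) - f x)] with [w_k = 2 ^ -(k+1)],
    and the jump sizes [y_k] grow extremely fast. Since the weights add up to
    [1], harmonicity of [h] means [h x = sum_k w_k h (x + y_k)].

    The function [h] is built by successive corrections, starting from a smooth
    bump [F_0] with support in [[-1, 1]]. Write [T_k f x = f (x + y_k)] and
    [Q_n = sum_(k < n) w_k T_k - 1], the truncated operator. The failure [Q_n F_n]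
    of harmonicity is repaired by means of the next jump: a copy of it, divided by
    [- w_n], is placed at distance [y_n], so that

      [F_(n+1) = F_n - (1 / w_n) T_n^-1 Q_n F_n].

    Since [Q_(n+1) = Q_n + w_n T_n], the new failure is
    [w_n T_n F_n - (1 / w_n) T_n^-1 Q_n Q_n F_n] (lemma [residueS]): both terms are
    shifted by [y_n], which is much larger than the supports involved, so every
    bounded interval is eventually free of failures. There, [F_n] is also
    eventually constant in [n], and the limit [h] satisfies the harmonicity
    identity as a finite sum (lemma [sum_harmonic]). A correction multiplies the
    sup norm by at most [1 + 2 / w_n], regardless of [y_n]; hence the amplitudes
    are bounded by a sequence fixed in advance, and the choice of [y_n] beyond all
    powers of the amplitude makes [h] grow more slowly than every power of [|x|]
    (lemma [harmonic_power]). As [h] vanishes on long intervals around its bumps,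
    it is not a polynomial.

    The choice of a lacunary sequence of sizes has a second effect, on which the
    statement about distributions rests: although [h] is large near [y_k], the
    term [w_k h (x + y_k)] is zero unless [|x|] is comparable with [y_(k-1)] or
    larger, and this gives the bound [4 * 2 ^ -k * (1 + x ^ 2)] (lemma
    [harmonic_jump_bound]), summable in [k] locally uniformly in [x]. A function
    with such a bound and with the harmonicity identity is called [balanced]
    below. Convolution with a rapidly decreasing function preserves this class
    ([balanced_rconv]); applied first to the function [psi] and then to [phi], this
    gives both the absolute convergence of the convolution of [L phi] with
    [h * psi] and its vanishing ([jump_convolution]).

    Finally, the characteristic exponent can vanish at [xi] only if
    [xi y_k] is in [2 pi Z] for all [k], and the ratio [y_1 / y_0] is irrational
    because its square is an odd power of [2]. *)

(** * Jump weights, jump sizes and amplitudes *)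
Section Scales.
Context {R : realType}.

Definition weight (n : nat) : R := 2 ^- n.+1.

(** The factor [2 ^+ ((n + 3) ^ 3)] outgrows every fixed power of [amplitude n];
    the powers of [sqrt 2] make two of the sizes incommensurable. *)
Definition site (n : nat) : R := 2 ^+ ((n + 3) ^ 3) * Num.sqrt 2 ^+ n.

(** Upper bound for the sup norm of the [n]-th partial sum of corrections. It is
    a function of the weights alone, so that the sizes of the jumps can be chosen
    large with respect to it. *)
Definition amplitude (n : nat) : R := 2 ^+ (n * (n + 2)).

(** Half-width of an interval around [0] that contains the support of the
    [n]-th partial sum. *)
Definition radius (n : nat) : R := if n is m.+1 then 2 * site m else 1.

Lemma weight_gt0 n : 0 < weight n.
Proof. by rewrite /weight invr_gt0 exprn_gt0. Qed.

Lemma sum_weight n : \sum_(k < n) weight k = 1 - 2 ^- n.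
Proof.
elim: n => [|n IH]; first by rewrite big_ord0 expr0 invr1 subrr.
rewrite big_ord_recr /= IH /weight exprS.
have : (2 : R) ^+ n != 0 by rewrite expf_neq0 // pnatr_eq0.
by move: (2 ^+ n) => z z0; field.
Qed.

Lemma le1_sqrt2 : 1 <= Num.sqrt (2 : R).
Proof. by rewrite -[X in X <= _]sqrtr1 ler_sqrt // ler1n. Qed.

Lemma le1_sqrt2X n : 1 <= Num.sqrt (2 : R) ^+ n.
Proof. by rewrite exprn_ege1 // le1_sqrt2. Qed.

Lemma amplitude_ge1 n : 1 <= amplitude n.
Proof. by rewrite /amplitude exprn_ege1 // ler1n. Qed.

Lemma amplitude_gt0 n : 0 < amplitude n.
Proof. exact: lt_le_trans (amplitude_ge1 n). Qed.

Lemma amplitude_ge_exp n : 2 ^+ n <= amplitude n.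
Proof. by rewrite /amplitude ler_weXn2l ?ler1n // leq_pmulr // addnS. Qed.

Lemma le_amplitude m n : (m <= n)%N -> amplitude m <= amplitude n.
Proof. by move=> mn; rewrite /amplitude ler_weXn2l ?ler1n // leq_mul // leq_add2r. Qed.

(** The factor on the left is the one by which a single correction step can
    enlarge the sup norm. *)
Lemma amplitudeS n :
  (1 + 2 * (weight n)^-1) * amplitude n <= amplitude n.+1.
Proof.
rewrite /weight invrK /amplitude.
have -> : (n.+1 * (n.+1 + 2) = (2 * n + 3) + n * (n + 2))%N by lia.
rewrite exprD ler_wpM2r ?exprn_ge0 //.
have h1 : (1 : R) <= 2 ^+ n by rewrite exprn_ege1 // ler1n.
have -> : (2 * n + 3 = n + n + 3)%N by lia.
rewrite !exprD exprS; move: (2 ^+ n : R) h1 => z; nra.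
Qed.

(** An amplitude raised to an exponent that tends to infinity is still below
    the distance at which it occurs: the source of sub-power growth. *)
Lemma amplitude_site n : amplitude n.+1 ^+ n.+2 <= site n.
Proof.
rewrite /site -[leLHS]mulr1 ler_pM ?le1_sqrt2X ?exprn_ge0 ?(ltW (amplitude_gt0 _)) //.
rewrite /amplitude -exprM ler_weXn2l ?ler1n //.
have -> : ((n + 3) ^ 3 = (n + 3) * (n + 3) * (n + 3))%N by rewrite !expnS; lia.
by nia.
Qed.

Lemma site0_ge10 : 10 <= site 0.
Proof.
rewrite /site expr0 mulr1.
by apply: le_trans (_ : 2 ^+ 4 <= _); [lra|rewrite ler_weXn2l ?ler1n].
Qed.

Lemma siteS n : 20 * site n <= site n.+1.
Proof.
rewrite /site exprS.
have -> : ((n.+1 + 3) ^ 3 = 5 + (3 * n * n + 21 * n + 32) + (n + 3) ^ 3)%N.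
  by rewrite !expnS; lia.
rewrite [2 ^+ (_ + _)]exprD [2 ^+ (5 + _)]exprD.
have h' : 1 <= (2 : R) ^+ (3 * n * n + 21 * n + 32) by rewrite exprn_ege1 // ler1n.
have h3 : 0 < (2 : R) ^+ ((n + 3) ^ 3) by rewrite exprn_gt0.
have := le1_sqrt2X n; have := le1_sqrt2; move: h' h3.
have -> : (2 : R) ^+ 5 = 32 by ring.
move: (Num.sqrt (2 : R)) (Num.sqrt (2 : R) ^+ n) => a b.
move: ((2 : R) ^+ (_ + 32)) ((2 : R) ^+ (_ ^ 3)) => e p e1 p0 a1 b1.
have pb0 : 0 < p * b by rewrite mulr_gt0 //; lra.
have -> : 32 * e * p * (a * b) = 32 * (e * a) * (p * b) by ring.
rewrite ler_wpM2r ?(ltW pb0) //.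
have : 1 <= e * a by rewrite mulr_ege1.
lra.
Qed.

Lemma site_gt0 n : 0 < site n.
Proof.
elim: n => [|n IH]; first exact: lt_le_trans site0_ge10.
by apply: lt_le_trans (siteS n); rewrite mulr_gt0.
Qed.

Lemma le_site m n : (m <= n)%N -> site m <= site n.
Proof.
move=> /subnKC <-; elim: (n - m)%N => [|k IH]; first by rewrite addn0.
by rewrite addnS (le_trans IH) // (le_trans _ (siteS _)) // ler_peMl ?(ltW (site_gt0 _)) // ler1n.
Qed.

Lemma site_ge10 n : 10 <= site n.
Proof. exact: le_trans site0_ge10 (le_site (leq0n n)). Qed.

Lemma site_ge_nat n : 2 * n%:R <= site n.
Proof.
elim: n => [|n IH]; first by rewrite mulr0 ltW // site_gt0.
apply: le_trans (siteS n); have := site_ge10 n; rewrite -[n.+1%:R]natr1.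
move: (n%:R : R) IH => z; lra.
Qed.

Lemma radius_ge1 n : 1 <= radius n.
Proof. by case: n => [//|n] /=; have := site_ge10 n; lra. Qed.

Lemma radius_site n : 10 * radius n <= site n.
Proof.
by case: n => [|n] /=; [have := site0_ge10|have := siteS n]; lra.
Qed.

Lemma site_radius k n : (k < n)%N -> 2 * site k <= radius n.
Proof. by case: n => [//|n] kn /=; rewrite ler_wpM2l // le_site. Qed.

End Scales.

(** * The successive corrections and their limit *)
Section Corrections.
Context {R : realType}.
Implicit Types (f g : R -> R) (n : nat).

Definition jump_op n f (x : R) : R :=
  \sum_(k < n) weight k * f (x + site k) - f x.

Context (g : R -> R).

(** With [T_k f x = f (x + site k)] and [Q_n = jump_op n], the step is
    [F_(n+1) = F_n - (1 / w_n) T_n^-1 Q_n F_n]: the new jump, sent from the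
    region where [Q_n F_n] lives, meets exactly the opposite of [Q_n F_n]. *)
Fixpoint corrected n : R -> R :=
  if n is m.+1 then
    fun x => corrected m x
             - (weight m)^-1 * jump_op m (corrected m) (x - site m)
  else g.

Definition residue n : R -> R := jump_op n (corrected n).

(** The corrections added after step [n] vanish for [|x| <= site n / 2], so the
    limit is reached at the index [truncn |x| + 1], because
    [2 * n <= site n]. *)
Definition harmonic (x : R) : R := corrected (Num.truncn `|x|).+1 x.

Lemma jump_op_bound n f c : (forall x, `|f x| <= c) ->
  forall x, `|jump_op n f x| <= 2 * c.
Proof.
move=> fc x; rewrite /jump_op; have c0 : 0 <= c := le_trans (normr_ge0 _) (fc x).
apply: le_trans (ler_normB _ _) _; rewrite mulr2n mulrDl mul1r lerD //.
apply: le_trans (ler_norm_sum _ _ _) _.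
apply: (@le_trans _ _ (\sum_(k < n) weight k * c)).
  apply: ler_sum => k _; rewrite normrM gtr0_norm ?weight_gt0 //.
  by rewrite ler_wpM2l // ltW // weight_gt0.
rewrite -mulr_suml sum_weight ler_piMl // gerBl invr_ge0 exprn_ge0 //.
Qed.

Lemma jump_op_support n f r : (forall x, r < `|x| -> f x = 0) ->
  forall x, r + radius n < `|x| -> jump_op n f x = 0.
Proof.
move=> f0 x rx; have r0 := @radius_ge1 R n.
rewrite /jump_op f0 ?subr0; last lra.
apply: big1 => k _; rewrite f0 ?mulr0 //.
have := @site_radius R k n (ltn_ord k); have := @site_gt0 R k.
have := ler_normB (x + site k) (site k); rewrite addrK.
by rewrite [`|site k|]ger0_norm ?(ltW (site_gt0 _)) //; lra.
Qed.

Context (g_bound : forall x, `|g x| <= 1).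
Context (g_support : forall x, 1 < `|x| -> g x = 0).

Lemma corrected_bound n x : `|corrected n x| <= amplitude n.
Proof.
elim: n x => [|n IH] x; first by rewrite (le_trans (g_bound x)) ?amplitude_ge1.
rewrite /=; apply: le_trans (ler_normB _ _) _.
apply: le_trans (amplitudeS n); rewrite mulrDl mul1r lerD //.
rewrite normrM gtr0_norm ?invr_gt0 ?weight_gt0 // [2 * _]mulrC -mulrA.
by rewrite ler_wpM2l ?invr_ge0 ?(ltW (weight_gt0 _)) // jump_op_bound.
Qed.

Lemma residue_bound n x : `|residue n x| <= 2 * amplitude n.
Proof. by apply: jump_op_bound; exact: corrected_bound. Qed.

Lemma corrected_support n x : radius n < `|x| -> corrected n x = 0.
Proof.
elim: n x => [|n IH] x; first exact: g_support.
rewrite [radius _]/= => nx; have rs := @radius_site R n; have r1 := @radius_ge1 R n.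
have := ler_normB x (site n).
rewrite /= IH ?(jump_op_support IH) ?mulr0 ?subrr //; last lra.
have := ler_normD (x - site n) (site n); rewrite subrK.
rewrite [`|site n|]ger0_norm ?(ltW (site_gt0 _)) //; lra.
Qed.

Lemma residue_support n x : 2 * radius n < `|x| -> residue n x = 0.
Proof.
by move=> nx; apply: jump_op_support (@corrected_support n) _ _; lra.
Qed.

(** Expanding [Q_(n+1) = Q_n + w_n T_n] on [F_n - (1 / w_n) T_n^-1 Q_n F_n], the
    two copies of [Q_n F_n] cancel, and the remaining terms are both shifted by
    the huge amount [site n]. *)
Lemma residueS n x : residue n.+1 x =
  weight n * corrected n (x + site n)
  - (weight n)^-1 * jump_op n (residue n) (x - site n).
Proof.
have w0 : weight n != 0 :> R by rewrite gt_eqF // weight_gt0.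
rewrite /residue [LHS]/jump_op big_ord_recr /= addrK mulrBr mulrA divff // mul1r.
set A := (X in X + _ - _).
have -> : A = \sum_(k < n) weight k * corrected n (x + site k)
   - (weight n)^-1 * \sum_(k < n) weight k * residue n (x - site n + site k).
  rewrite /A mulr_sumr -sumrB; apply: eq_bigr => k _.
  by rewrite mulrBr mulrCA (addrAC x).
rewrite [residue n]/residue [jump_op n (jump_op _ _) _]/jump_op.
rewrite -[in X in _ - _ + (_ - X)]/(residue n x) /residue.
rewrite [X in _ + (_ - X)]/jump_op.
set B := \sum_(k < n) _; set C := \sum_(k < n) _.
set D := jump_op _ _ _; set a := (weight n)^-1.
ring.
Qed.

Lemma residueS_eq0 n x : `|x| <= site n / 2 -> residue n.+1 x = 0.
Proof.
move=> xs; have rs := @radius_site R n; have r1 := @radius_ge1 R n.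
have s0 := @site_gt0 R n.
have h1 : site n / 2 <= `|x + site n|.
  have := ler_normB (x + site n) x; rewrite addrC addKr (gtr0_norm s0); lra.
have h2 : site n / 2 <= `|x - site n|.
  have := ler_normD (site n - x) x; rewrite subrK (gtr0_norm s0) distrC; lra.
rewrite residueS corrected_support ?(jump_op_support (@residue_support n)); lra.
Qed.

Lemma correctedS_eq n x : `|x| <= site n / 2 -> corrected n.+1 x = corrected n x.
Proof.
move=> xs; have rs := @radius_site R n; have r1 := @radius_ge1 R n.
have s0 := @site_gt0 R n.
have h2 : site n / 2 <= `|x - site n|.
  have := ler_normD (site n - x) x; rewrite subrK (gtr0_norm s0) distrC; lra.
by rewrite /= -/(residue n _) residue_support ?mulr0 ?subr0 //; lra.
Qed.

Lemma corrected_eq n m x : (n <= m)%N -> `|x| <= site n / 2 ->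
  corrected m x = corrected n x.
Proof.
move=> /subnKC <-; elim: (m - n)%N => [|k IH] xs; first by rewrite addn0.
rewrite addnS correctedS_eq ?IH //; apply: le_trans xs _.
by rewrite ler_wpM2r ?invr_ge0 // le_site // leq_addr.
Qed.

Lemma le_truncn_site (x : R) : `|x| <= site (Num.truncn `|x|).+1 / 2.
Proof.
have := @site_ge_nat R (Num.truncn `|x|).+1.
have := truncnS_gt `|x|; move: (_.+1%:R) => z; lra.
Qed.

Lemma harmonicE n x : `|x| <= site n / 2 -> harmonic x = corrected n x.
Proof.
move=> xs; rewrite /harmonic; have xt := le_truncn_site x.
by case: (leqP n (Num.truncn `|x|).+1) => nm; [|symmetry];
  apply: corrected_eq => //; exact: ltnW.
Qed.

(** Around [site k], the limit function is the [k]-th correction alone: the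
    previous ones do not reach that far, and the later ones start much
    further away. *)
Lemma harmonic_jump k x : `|x| <= site k / 2 ->
  weight k * harmonic (x + site k) = - residue k x.
Proof.
move=> xs; have rs := @radius_site R k; have r1 := @radius_ge1 R k.
have s0 := @site_gt0 R k; have sS := @siteS R k.
have w0 : weight k != 0 :> R by rewrite gt_eqF // weight_gt0.
have h1 : site k / 2 <= `|x + site k|.
  have := ler_normB (x + site k) x; rewrite addrC addKr (gtr0_norm s0); lra.
have h2 := ler_normD x (site k); rewrite (gtr0_norm s0) in h2.
rewrite (@harmonicE k.+1) /=; last lra.
rewrite corrected_support ?addrK; last lra.
by rewrite sub0r mulrN mulrA divff // mul1r.
Qed.

(** Harmonicity in its sharpest form: near a given point, a long enough finite
    part of the jump sum already returns the value of the function. *)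
Lemma sum_harmonic n x : `|x| <= site n / 2 ->
  \sum_(k < n.+1) weight k * harmonic (x + site k) = harmonic x.
Proof.
move=> xs; have := residueS_eq0 xs; rewrite /residue /jump_op.
have sS := @siteS R n; have s0 := @site_gt0 R n.
move/eqP; rewrite subr_eq0 => /eqP; rewrite -(@harmonicE n.+1); last lra.
move=> <-; apply: eq_bigr => k _; rewrite (@harmonicE n.+1) //.
have := @le_site R k n; rewrite -ltnS ltn_ord => /(_ isT).
have := ler_normD x (site k); rewrite (gtr0_norm (site_gt0 k)); lra.
Qed.

(** The index [m] is the last one with [site m] below [2 |x|]; the corrections
    that come after it start too far away to reach [x]. *)
Lemma harmonic_cases x : `|harmonic x| <= 1 \/ exists m,
  site m < 2 * `|x| /\ `|harmonic x| <= amplitude m.+1.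
Proof.
have ex : exists n, `|x| <= site n / 2.
  by exists (Num.truncn `|x|).+1; exact: le_truncn_site.
have [[|m] xm min] := ex_minnP ex.
  by left; rewrite (harmonicE xm) (le_trans (corrected_bound _ _)).
right; exists m; split; last by rewrite (harmonicE xm) corrected_bound.
rewrite ltNge; apply/negP => mx; suff : (m < m)%N by rewrite ltnn.
by apply: min; lra.
Qed.

Lemma harmonic_linear x : `|harmonic x| <= 1 + 2 * `|x|.
Proof.
have [h|[m [mx h]]] := harmonic_cases x.
  by apply: le_trans h _; have := normr_ge0 x; lra.
apply: le_trans h _; have := @amplitude_site R m.
have : amplitude m.+1 <= amplitude m.+1 ^+ m.+2 :> R.
  by rewrite ler_eXnr // amplitude_ge1.
lra.
Qed.

Lemma harmonic_power j x :
  `|harmonic x| ^+ j <= amplitude j ^+ j + 2 * `|x|.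
Proof.
have x0 := normr_ge0 x.
have aj : 1 <= amplitude j ^+ j :> R by rewrite exprn_ege1 // amplitude_ge1.
have [h|[m [mx h]]] := harmonic_cases x.
  have : `|harmonic x| ^+ j <= 1 by rewrite exprn_ile1.
  lra.
have hj : `|harmonic x| ^+ j <= amplitude m.+1 ^+ j.
  by rewrite lerXn2r // nnegrE // ltW // amplitude_gt0.
have [jm|mj] := leqP j m.+2.
  have : amplitude m.+1 ^+ j <= amplitude m.+1 ^+ m.+2 :> R.
    by rewrite ler_weXn2l // amplitude_ge1.
  have := @amplitude_site R m; lra.
have : amplitude m.+1 ^+ j <= amplitude j ^+ j :> R.
  rewrite lerXn2r ?nnegrE ?(ltW (amplitude_gt0 _)) // le_amplitude //.
  exact: ltnW (ltnW mj).
lra.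
Qed.

(** Summability in [k] is the balance between jump sizes and growth: a jump
    of weight [weight k] lands on a correction of size [1 / weight k], but this
    correction is not felt until [|x|] is comparable with [site k.-1]. *)
Lemma harmonic_jump_bound k x :
  `|weight k * harmonic (x + site k)| <= 4 * 2 ^- k * (1 + x ^+ 2).
Proof.
have x0 := normr_ge0 x; have xx : `|x| ^+ 2 = x ^+ 2 by rewrite real_normK ?num_real.
have p0 : (0 : R) < 2 ^- k by rewrite invr_gt0 exprn_gt0.
have [xs|xs] := leP `|x| (site k / 2); last first.
  rewrite normrM gtr0_norm ?weight_gt0 // /weight exprS invfM.
  have h := harmonic_linear (x + site k).
  have := ler_normD x (site k); rewrite (gtr0_norm (site_gt0 k)) => h2.
  have {h2}h : `|harmonic (x + site k)| <= 1 + 6 * `|x| by lra.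
  rewrite -xx; move: (`|x|) (`|harmonic _|) (2 ^- k) x0 h p0 => a b p a0 ba p0.
  have : b <= 8 * (1 + a ^+ 2) by nra.
  nra.
rewrite harmonic_jump // normrN.
case: k xs p0 => [|m] xs q0.
  have := residue_bound 0 x; rewrite /amplitude mul0n !expr0 invr1 -xx.
  nra.
have [xm|mx] := leP `|x| (site m / 2).
  by rewrite residueS_eq0 // normr0 mulr_ge0 ?mulr_ge0 ?(ltW q0) // -xx; nra.
apply: le_trans (residue_bound _ _) _.
have ha := @amplitude_ge_exp R m.+1.
have hs : amplitude m.+1 * amplitude m.+1 <= site m :> R.
  apply: le_trans (amplitude_site m); rewrite -expr2.
  by rewrite ler_weXn2l ?amplitude_ge1.
have e0 : (0 : R) < 2 ^+ m.+1 by rewrite exprn_gt0.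
rewrite -mulrA mulrCA ler_pdivlMl // -xx.
have a1 := @amplitude_ge1 R m.+1.
move: (`|x|) (2 ^+ m.+1) (amplitude m.+1) (site m) ha hs e0 mx x0 a1.
move=> b p a s pa as' p0 sb b0 a1.
have : p * a <= a * a by rewrite ler_wpM2r //; lra.
nra.
Qed.

End Corrections.

(** * Smooth functions *)
Section Smooth.
Context {R : realType}.
Implicit Types u v : R -> R.

(** Coinduction, which replaces formulas for iterated derivatives by the choice of
    a class closed under differentiation. *)
Lemma smooth_coind (S : set (R -> R)) :
  (forall u, S u -> (forall x, derivable u x 1) /\ S (u^`())%classic) ->
  forall u, S u -> smooth u.
Proof.
move=> Sd u Su n; suff /Sd[] : S (u^`(n))%classic by [].
by elim: n => [//|n /Sd[_]]; rewrite derive1nS.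
Qed.

Lemma smooth_derivable u : smooth u -> forall x, derivable u x 1.
Proof. by move/(_ 0%N). Qed.

Lemma smooth_derive u : smooth u -> smooth (u^`())%classic.
Proof. by move=> su n; have := su n.+1; rewrite derive1Sn. Qed.

Lemma smooth_continuous u : smooth u -> continuous u.
Proof.
by move=> su x; apply/differentiable_continuous/derivable1_diffP/smooth_derivable.
Qed.

(** Derivatives of [u x + c * v (s * x + a)] have again this form, with [u], [v]
    differentiated and [c] multiplied by [s]. *)
Lemma smooth_affine u v c s a : smooth u -> smooth v ->
  smooth (fun x => u x + c * v (s * x + a)).
Proof.
move=> su sv; pose S := [set w : R -> R | exists u v c,
  [/\ smooth u, smooth v & w = fun x => u x + c * v (s * x + a)]].
apply: (@smooth_coind S); last by exists u, v, c.
move=> _ [{}u [{}v [{}c [{}su {}sv ->]]]].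
have d (x : R) : is_derive x (1 : R) (fun x : R => u x + c * v (s * x + a))
    ((u^`())%classic x + c * s * (v^`())%classic (s * x + a)).
  have du : is_derive x (1 : R) u ((u^`())%classic x).
    by rewrite derive1E; apply/derivableP/smooth_derivable.
  have dv : is_derive (s * x + a) (1 : R) v ((v^`())%classic (s * x + a)).
    by rewrite derive1E; apply/derivableP/smooth_derivable.
  have da : is_derive x (1 : R) (fun x : R => s * x + a) s.
    have -> : (fun x : R => s * x + a) = (s \*: id) + cst a by apply/funext.
    by apply: is_derive_eq; rewrite addr0 /GRing.scale /= mulr1.
  have dva := @is_derive1_comp _ v (fun x => s * x + a) x _ _ dv da.
  have -> : (fun x => u x + c * v (s * x + a))
    = u + c \*: (v \o (fun x => s * x + a)) by apply/funext.
  by apply: is_derive_eq; rewrite /GRing.scale /=; ring.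
split; first by move=> x; case: (d x).
exists (u^`())%classic, (v^`())%classic, (c * s).
split; [exact: smooth_derive|exact: smooth_derive|].
by apply/funext => x; rewrite derive1E; case: (d x).
Qed.

Lemma smooth_cst c : smooth (fun _ : R => c).
Proof.
apply: (@smooth_coind [set u | exists c, u = cst c]); last by exists c.
move=> _ [d ->]; split => //; exists 0.
by apply/funext => x; rewrite derive1_cst.
Qed.

(** The sums of products of derivatives, a class closed under the product rule
    and hence suitable for [smooth_coind]. *)
Inductive leibniz_span u v : (R -> R) -> Prop :=
| LeibnizProd i j :
    leibniz_span u v (fun x => u^`(i)%classic x * v^`(j)%classic x)
| LeibnizAdd w z : leibniz_span u v w -> leibniz_span u v z ->
    leibniz_span u v (fun x => w x + z x).

Lemma smooth_mul u v : smooth u -> smooth v -> smooth (fun x => u x * v x).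
Proof.
move=> su sv; apply: (@smooth_coind (leibniz_span u v));
  last exact: (LeibnizProd u v 0 0).
move=> w; elim => {w} [i j|w z _ [dw Sw] _ [dz Sz]]; last first.
  split; first by move=> x; apply: derivableD.
  have -> : ((fun x => w x + z x)^`())%classic =
      fun x => (w^`())%classic x + (z^`())%classic x.
    by apply/funext => x; rewrite derive1E deriveD // -!derive1E.
  exact: LeibnizAdd Sw Sz.
split; first by move=> x; apply: derivableM; [exact: su|exact: sv].
have -> : ((fun x => u^`(i)%classic x * v^`(j)%classic x)^`())%classic =
    fun x => u^`(i)%classic x * v^`(j.+1)%classic x
             + u^`(i.+1)%classic x * v^`(j)%classic x.
  apply/funext => x; rewrite derive1E deriveM; [|exact: su|exact: sv].
  rewrite !derive1nS -!derive1E /GRing.scale /=.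
  by rewrite [X in _ + X]mulrC.
exact: (LeibnizAdd (LeibnizProd u v i j.+1) (LeibnizProd u v i.+1 j)).
Qed.

(** Smoothness is local, which is how it passes to the limit of functions that
    are stationary on every bounded interval. *)
Lemma smooth_local u :
  (forall r, 0 < r -> exists2 v, smooth v & forall x, `|x| < r -> u x = v x) ->
  smooth u.
Proof.
pose S := [set u : R -> R | forall r, 0 < r ->
  exists2 v, smooth v & forall x, `|x| < r -> u x = v x].
apply: (@smooth_coind S) => {}u Su.
have uv x r v : `|x| < r -> (forall x, `|x| < r -> u x = v x) -> \near x, u x = v x.
  move=> xr uv; near=> z; apply: uv; near: z.
  have : open [set z : R | `|z| < r].
    have -> : [set z : R | `|z| < r] = ball (0 : R) r.
      by apply/seteqP; split=> z /=; rewrite /ball /= sub0r normrN.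
    exact: ball_open.
  by rewrite openE /=; apply.
split.
  move=> x; have [|v sv e] := Su (`|x| + 1); first by rewrite ltr_wpDl.
  apply: (@near_eq_derivable _ _ _ v u x 1).
    by near do apply/esym; apply: uv e; rewrite ltrDl.
  exact: smooth_derivable.
move=> r r0; have [v sv e] := Su r r0.
exists (v^`())%classic; first exact: smooth_derive.
move=> x xr; rewrite !derive1E; apply: near_eq_derive; exact: uv e.
Unshelve. all: by end_near. Qed.

End Smooth.

(** * A smooth bump function *)
Section Bump.
Context {R : realType}.

(** The functions [p(1/x) * exp (- 1/x)], extended by zero to [x <= 0]. As [p]
    varies, they form a class stable under differentiation. *)
Definition flat (p : {poly R}) (x : R) : R :=
  if 0 < x then p.[x^-1] * expR (- x^-1) else 0.

(** Each monomial is handled by [t ^ i / i! <= exp t]. *)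
Lemma horner_expR_bound (p : {poly R}) :
  exists2 C, 0 <= C & forall t, 0 <= t -> `|p.[t]| * expR (- t) <= C.
Proof.
exists (\sum_(i < size p) `|p`_i| * i`!%:R).
  by apply: sumr_ge0 => i _; rewrite mulr_ge0.
move=> t t0; rewrite horner_coef; apply: le_trans.
  by apply: ler_wpM2r; [exact: expR_ge0|exact: ler_norm_sum].
rewrite mulr_suml; apply: ler_sum => i _.
rewrite normrM -mulrA ler_wpM2l // ger0_norm ?exprn_ge0 //.
rewrite expRN ler_pdivrMr ?expR_gt0 //.
have f0 : 0 < i`!%:R :> R by rewrite ltr0n fact_gt0.
rewrite mulrC -ler_pdivrMr //.
case: (nat_of_ord i) => [|n].
  by rewrite expr0 fact0 invr1 mulr1 -[leLHS]expR0 ler_expR.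
by apply: le_trans (expR_ge1Dxn n t0); rewrite lerDr ler01.
Qed.

(** At the origin the difference quotient is [x * q(1/x) * exp (- 1/x)] with
    [q = 'X^2 * p], and [q(t) * exp (- t)] is bounded. *)
Lemma flat_derive0 p : is_derive (0 : R) (1 : R) (flat p) 0.
Proof.
have [C C0 bC] := horner_expR_bound ('X^2 * p).
have q h : `|h^-1 * flat p h| <= `|h| * C.
  rewrite /flat; case: ifPn => [h0|_]; last by rewrite mulr0 normr0 mulr_ge0.
  have hi : 0 < h^-1 by rewrite invr_gt0.
  have := bC h^-1 (ltW hi); rewrite hornerM hornerXn expr2 !normrM.
  rewrite (gtr0_norm h0) (gtr0_norm hi) (ger0_norm (expR_ge0 _)) -ler_pdivrMl //.
  by rewrite !mulrA.
have c : (fun h => h^-1 *: ((flat p \o shift 0) (h *: 1) - flat p 0)) @ (0:R)^' --> (0 : R).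
  have e : (fun h => h^-1 *: ((flat p \o shift 0) (h *: 1) - flat p 0))
    = (fun h => h^-1 * flat p h).
    apply/funext => h /=; rewrite /shift /= addr0 /GRing.scale /= mulr1.
    by rewrite [flat p 0]/flat ltxx subr0.
  rewrite e; apply/norm_cvg0P.
  have z : (fun h : R => `|h| * C) @ (0:R)^' --> (0 : R).
    apply: cvg_within_filter.
    have : (fun h : R => `|h| * C) @ (0 : R) --> `|0 : R| * C.
      by apply: cvgM; [exact: (@norm_continuous _ R)|exact: cvg_cst].
    by rewrite normr0 mul0r.
  apply: (@squeeze_cvgr _ _ _ _ (fun=> 0) (fun h => `|h| * C)) z.
    by near=> h; rewrite normr_ge0 q.
  exact: cvg_cst.
split; first by apply/cvg_ex; exists 0.
exact/cvg_lim.
Unshelve. all: by end_near. Qed.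

Lemma flat_derive p (x : R) : is_derive x (1 : R) (flat p) (flat ('X^2 * (p - p^`())) x).
Proof.
have [x0|x0|->] := ltrgt0P x; last first.
- apply: is_derive_eq (flat_derive0 p) _; by rewrite /flat ltxx.
- have -> : flat ('X^2 * (p - p^`())) x = 0 by rewrite /flat ltNge (ltW x0).
  apply: (@near_eq_is_derive _ _ _ (cst 0)).
  near=> z; rewrite /flat ltNge; case: ifPn => //; rewrite -ltNge => z0.
  suff : z < 0 by rewrite ltNge (ltW z0).
  near: z; exact: lt_nbhsl.
have -> : flat ('X^2 * (p - p^`())) x = ('X^2 * (p - p^`())).[x^-1] * expR (- x^-1).
  by rewrite /flat x0.
apply: (@near_eq_is_derive R R R (fun x : R => p.[x^-1] * expR (- x^-1))).
  near=> z; rewrite /flat; suff -> : 0 < z by [].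
  near: z; exact: lt_nbhsr.
have xn0 : x != 0 by rewrite gt_eqF.
have di : is_derive x (1 : R) (fun x : R => x^-1) (- x ^- 2).
  have := @is_deriveV _ (@idfun R) x 1 1 xn0 _.
  by rewrite /GRing.scale /= mulr1; apply; exact: is_derive_id.
have dp : is_derive x^-1 (1 : R) (horner p) (p^`()).[x^-1].
  by rewrite derivE derive1E; apply/derivableP/derivable_horner.
have dpi := @is_derive1_comp _ (horner p) (fun x => x^-1) x _ _ dp di.
have dn : is_derive x (1 : R) (fun x : R => - x^-1) (x ^- 2).
  have := @is_deriveN _ _ _ _ _ _ _ di; rewrite opprK; exact.
have de := @is_derive1_comp _ (@expR R) (fun x => - x^-1) x _ _ (is_derive_expR _) dn.
apply: is_derive_eq (@is_deriveM _ _ _ _ _ _ _ _ dpi de) _.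
by rewrite /GRing.scale /= !hornerE /= exprVn; ring.
Unshelve. all: by end_near. Qed.

Lemma flat_smooth p : smooth (flat p).
Proof.
apply: (@smooth_coind R [set u | exists p, u = flat p]); last by exists p.
move=> _ [q ->]; split; first by move=> x; case: (flat_derive q x).
exists ('X^2 * (q - q^`())); apply/funext => x.
by rewrite derive1E; case: (flat_derive q x).
Qed.

Definition bump (x : R) : R := flat 1 (x + 1) * flat 1 (- x + 1).

Lemma bump_smooth : smooth bump.
Proof.
have e (s : R) : smooth (fun x : R => flat 1 (s * x + 1)).
  have := @smooth_affine R _ _ 1 s 1 (@smooth_cst R 0) (@flat_smooth 1).
  by under eq_fun do rewrite add0r mul1r.
have -> : bump = fun x : R => flat 1 (1 * x + 1) * flat 1 (-1 * x + 1).
  by apply/funext => x; rewrite /bump mul1r mulN1r.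
exact: (smooth_mul (e 1) (e (-1))).
Qed.

Lemma flat1_bound (x : R) : 0 <= flat 1 x <= 1.
Proof.
rewrite /flat; case: ifPn => [x0|_]; last by rewrite lexx ler01.
by rewrite hornerC mul1r expR_ge0 expR_le1 oppr_le0 invr_ge0 ltW.
Qed.

Lemma bump_bound x : `|bump x| <= 1.
Proof.
have /andP[a0 a1] := flat1_bound (x + 1).
have /andP[b0 b1] := flat1_bound (- x + 1).
by rewrite ger0_norm /bump ?mulr_ge0 // mulr_ile1.
Qed.

Lemma bump_support x : 1 < `|x| -> bump x = 0.
Proof.
rewrite /bump /flat; have [x0|x0] := ger0P x => x1.
  by rewrite [X in _ * X]ifF ?mulr0 //; apply/negbTE; rewrite -leNgt; lra.
by rewrite ifF ?mul0r //; apply/negbTE; rewrite -leNgt; lra.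
Qed.

Lemma bump0_neq0 : bump 0 != 0.
Proof.
by rewrite /bump oppr0 add0r /flat ltr01 hornerC mul1r mulf_neq0 // gt_eqF // expR_gt0.
Qed.

End Bump.

(** * Smoothness of the limit function *)
Section HarmonicSmooth.
Context {R : realType}.
Context (g : R -> R) (g_smooth : smooth g).
Context (g_support : forall x, 1 < `|x| -> g x = 0).

Lemma jump_op_smooth n (f : R -> R) : smooth f -> smooth (jump_op n f).
Proof.
move=> sf.
have : smooth (fun x => \sum_(k < n) weight k * f (x + site k)).
  elim: n => [|n IH].
    by under eq_fun do rewrite big_ord0; exact: smooth_cst.
  under eq_fun do rewrite big_ord_recr /= -[X in _ * f (X + _)]mul1r.
  exact: smooth_affine.
move=> s; have := @smooth_affine _ _ _ (-1) 1 0 s sf.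
congr smooth; apply/funext => x.
by rewrite /jump_op mul1r addr0 mulN1r.
Qed.

Lemma corrected_smooth n : smooth (corrected g n).
Proof.
elim: n => [//|n IH] /=.
have := @smooth_affine _ _ _ (- (weight n)^-1) 1 (- site n) IH (@jump_op_smooth n _ IH).
by congr smooth; apply/funext => x; rewrite mul1r mulNr.
Qed.

Lemma harmonic_smooth : smooth (harmonic g).
Proof.
apply: smooth_local => r r0.
exists (corrected g (Num.truncn r).+1); first exact: corrected_smooth.
move=> x xr; apply: harmonicE => //.
have := @le_truncn_site R r; rewrite (gtr0_norm r0); lra.
Qed.

End HarmonicSmooth.

(** * Termwise integration of series *)
Section Series.
Context {R : realType}.

Lemma geometric_dominated_cvg (a : nat -> R) c :
  (forall k, `|a k| <= c * 2 ^- k) -> cvgn (fun n => \sum_(k < n) a k).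
Proof.
move=> ac; have -> : (fun n => \sum_(k < n) a k) = series a.
  by apply/funext => n; rewrite /series /= big_mkord.
apply: normed_cvg.
apply: (@series_le_cvg _ _ (geometric c (2^-1))).
- by move=> n /=.
- by move=> n; rewrite /= exprVn (le_trans _ (ac n)).
- by move=> n; rewrite /= exprVn.
- by apply: is_cvg_geometric_series; rewrite gtr0_norm ?invr_gt0 // invf_lt1 // ltr1n.
Qed.

Lemma eseries_EFin (a : nat -> R) l :
  (fun n => \sum_(k < n) a k) @ \oo --> l -> (\sum_(k <oo) (a k)%:E = l%:E)%E.
Proof.
move=> al; apply/cvg_lim => //.
under eq_fun do rewrite big_mkord sumEFin.
by apply: cvg_EFin => //; exact: nearW.
Qed.

Lemma geometric_eseries_lty (a : nat -> \bar R) c :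
  (forall k, (a k <= (c * 2 ^- k)%:E)%E) -> (forall k, (0 <= a k)%E) ->
  (\sum_(k <oo) a k < +oo)%E.
Proof.
move=> ac a0.
have c0 : 0 <= c.
  have := le_trans (a0 0%N) (ac 0%N).
  by rewrite expr0 invr1 mulr1 lee_fin.
have [l cl] : exists l : R, (fun n => \sum_(k < n) (c * 2 ^- k)) @ \oo --> l.
  apply/cvg_ex; apply: (@geometric_dominated_cvg (fun k => c * 2 ^- k) c) => k.
  by rewrite ger0_norm // mulr_ge0 // invr_ge0 exprn_ge0.
apply: (@le_lt_trans _ _ (\sum_(k <oo) (c * 2 ^- k)%:E)%E).
  by apply: lee_nneseries => // k _ _; exact: a0.
by rewrite (eseries_EFin cl) ltry.
Qed.

Context d (T : measurableType d) (mu : {measure set T -> \bar R}).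

(** By dominated convergence: the dominating function is the sum of the absolute
    values, integrable by monotone convergence. *)
Lemma integral_series (f : nat -> T -> R) (s : T -> R) c :
  (forall k, measurable_fun setT (f k)) ->
  (forall k, (\int[mu]_x `|(f k x)%:E| <= (c * 2 ^- k)%:E)%E) ->
  (forall x, (fun n => \sum_(k < n) f k x) @ \oo --> s x) ->
  mu.-integrable setT (EFin \o s) /\
  (fun n => \sum_(k < n) Rintegral mu setT (f k)) @ \oo --> Rintegral mu setT s.
Proof.
move=> mf fc fs.
have intf k : mu.-integrable setT (EFin \o f k).
  apply/integrableP; split; first exact/measurable_EFinP.
  by apply: le_lt_trans (fc k) _; rewrite ltry.
pose g x : \bar R := (\sum_(k <oo) `|(f k x)%:E|)%E.
have mabs k : measurable_fun setT (fun x => `|(f k x)%:E|%E).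
  by apply: measurableT_comp => //; exact/measurable_EFinP.
have mg : measurable_fun setT g.
  by apply: ge0_emeasurable_sum => // k x _ _; exact: abse_ge0.
have g0 x : (0 <= g x)%E by apply: nneseries_ge0 => k _ _; exact: abse_ge0.
have ig : mu.-integrable setT g.
  apply/integrableP; split => //.
  under eq_integral do rewrite (gee0_abs (g0 _)).
  rewrite integral_nneseries //; apply: geometric_eseries_lty fc _ => k.
  exact: integral_ge0.
pose S n x : \bar R := (\sum_(k < n) f k x)%:E.
have mS n : measurable_fun setT (S n).
  by apply/measurable_EFinP/measurable_sum => k.
have ms : measurable_fun setT (EFin \o s).
  apply: (@emeasurable_fun_cvg _ _ _ _ S) => // x _.
  by apply: cvg_EFin; [exact: nearW|exact: fs].
have Sg x n : (`|S n x| <= g x)%E.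
  apply: (@le_trans _ _ (\sum_(k < n) `|(f k x)%:E|)%E).
    by rewrite /S -sumEFin; exact: lee_abs_sum.
  rewrite -(big_mkord xpredT (fun k => `|(f k x)%:E|%E)).
  by apply: nneseries_lim_ge => k _ _; exact: abse_ge0.
have Ss : {ae mu, forall x, setT x -> S ^~ x @ \oo --> (EFin \o s) x}.
  by apply/aeW => x _; apply: cvg_EFin; [exact: nearW|exact: fs].
have Sg' : {ae mu, forall x n, setT x -> (`|S n x| <= g x)%E}.
  by apply/aeW => x n _; exact: Sg.
have [is_ _ lims] := dominated_convergence measurableT mS ms Ss ig Sg'.
split=> //.
have fin_s := integrable_fin_num measurableT is_.
move: lims; rewrite -(fineK fin_s) => /fine_cvg; rewrite -/(Rintegral mu setT s).
have <- // : (fun n => \sum_(k < n) Rintegral mu setT (f k)) =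
   fine \o [sequence (\int[mu]_x S n x)%E]_n.
apply/funext => n /=; rewrite /S.
under [in RHS]eq_integral do rewrite -sumEFin.
rewrite integral_sum; [|exact: measurableT|by move=> k; exact: intf].
by rewrite -sum_fine // => k _; apply: integrable_fin_num; [exact: measurableT|exact: intf].
Qed.

End Series.

(** * Discrete Levy measure *)
Section LevyMeasure.
Context {R : realType}.
Implicit Types f : R -> R.

Definition weight_nng (k : nat) : {nonneg R} := NngNum (ltW (weight_gt0 k)).

Definition jump_atom (k : nat) : {measure set (measurableTypeR R) -> \bar R} :=
  mscale (weight_nng k) (dirac (site k : measurableTypeR R)).

Definition jump_measure : {measure set (measurableTypeR R) -> \bar R} :=
  mseries jump_atom 0.

Local Notation punctured := ([set~ 0] : set (measurableTypeR R)).

Let measurable_punctured : measurable punctured.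
Proof. by apply: measurableC; exact: measurable_set1. Qed.

Lemma jump_atom_integral k (f : measurableTypeR R -> \bar R) :
  measurable_fun punctured f -> (forall y, 0 <= f y)%E ->
  (\int[jump_atom k]_(y in punctured) f y = (weight k)%:E * f (site k))%E.
Proof.
move=> mf f0; rewrite ge0_integral_mscale //.
rewrite integral_dirac //.
have s0 : punctured (site k) by move=> /eqP; rewrite gt_eqF // site_gt0.
by rewrite diracE mem_set ?mul1e.
Qed.

Lemma jump_measure_ge0_integral (f : measurableTypeR R -> \bar R) :
  measurable_fun punctured f -> (forall y, 0 <= f y)%E ->
  (\int[jump_measure]_(y in punctured) f y =
   \sum_(k <oo) (weight k)%:E * f (site k))%E.
Proof.
move=> mf f0; rewrite ge0_integral_measure_series //.
by apply: eq_eseriesr => k _; rewrite jump_atom_integral.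
Qed.

Lemma jump_measure_integrable f c : measurable_fun setT f ->
  (forall k, `|weight k * f (site k)| <= c * 2 ^- k) ->
  jump_measure.-integrable punctured (EFin \o f).
Proof.
move=> mf fc; have mf' : measurable_fun punctured (EFin \o f).
  by apply/measurable_EFinP; exact: measurable_funTS.
apply/integrableP; split => //.
rewrite jump_measure_ge0_integral //; last by apply: measurableT_comp.
apply: (@geometric_eseries_lty _ _ c) => k /=.
  rewrite lee_fin; apply: le_trans (fc k).
  by rewrite normrM gtr0_norm ?weight_gt0.
by rewrite lee_fin mulr_ge0 // ltW // weight_gt0.
Qed.

(** Positive and negative parts are summed separately, where the integral
    against a series of measures is a series of nonnegative numbers. *)
Lemma jump_measure_Rintegral f c l : measurable_fun setT f ->
  (forall k, `|weight k * f (site k)| <= c * 2 ^- k) ->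
  (fun n => \sum_(k < n) weight k * f (site k)) @ \oo --> l ->
  Rintegral jump_measure punctured f = l.
Proof.
move=> mf fc fl; have intf := jump_measure_integrable mf fc.
have wp k : 0 <= weight k :> R := ltW (weight_gt0 k).
have mf' : measurable_fun punctured (EFin \o f).
  by apply/measurable_EFinP; exact: measurable_funTS.
pose fp := fun y => Num.max (f y) 0; pose fn := fun y => Num.max (- f y) 0.
have bp k : `|weight k * fp (site k)| <= c * 2 ^- k.
  apply: le_trans (fc k); rewrite !normrM ler_wpM2l // /fp maxEle.
  by case: ifP => _ //; rewrite normr0.
have bn k : `|weight k * fn (site k)| <= c * 2 ^- k.
  apply: le_trans (fc k); rewrite !normrM ler_wpM2l // /fn maxEle.
  by case: ifP => _ //; rewrite ?normr0 ?normrN.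
have /cvg_ex[/= lp clp] := geometric_dominated_cvg bp.
have /cvg_ex[/= ln cln] := geometric_dominated_cvg bn.
have efp : (\int[jump_measure]_(y in punctured) ((EFin \o f)^\+ y) = lp%:E)%E.
  rewrite jump_measure_ge0_integral //; last exact: measurable_funepos.
  transitivity (\sum_(k <oo) (weight k * fp (site k))%:E)%E.
    by apply: eq_eseriesr => k _; rewrite funeposE /= -EFin_max.
  exact: eseries_EFin.
have efn : (\int[jump_measure]_(y in punctured) ((EFin \o f)^\- y) = ln%:E)%E.
  rewrite jump_measure_ge0_integral //; last exact: measurable_funeneg.
  transitivity (\sum_(k <oo) (weight k * fn (site k))%:E)%E.
    by apply: eq_eseriesr => k _; rewrite funenegE /= -EFin_max.
  exact: eseries_EFin.
rewrite /Rintegral integralE efp efn /=.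
have : (fun n => \sum_(k < n) weight k * f (site k)) @ \oo --> lp - ln.
  have -> : (fun n => \sum_(k < n) weight k * f (site k)) =
     (fun n => \sum_(k < n) weight k * fp (site k) - \sum_(k < n) weight k * fn (site k)).
    apply/funext => n; rewrite -sumrB; apply: eq_bigr => k _.
    rewrite -mulrBr; congr (_ * _); rewrite /fp /fn !maxEle oppr_le0.
    by case: (lerP (f (site k)) 0) => h; case: ifP => h'; lra.
  exact: cvgB.
by move/cvg_lim => <- //; apply/cvg_lim.
Qed.

Lemma site_ge1 k : 1 <= site k :> R.
Proof. by apply: le_trans (site_ge10 k); rewrite ler1n. Qed.

Lemma jump_measure0 : jump_measure [set 0] = 0%E.
Proof.
rewrite /= /mseries eseries0 // => k _ _.
rewrite -[LHS]/((weight k)%:E * \d_(site k : measurableTypeR R) [set 0%R])%E.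
by rewrite diracE memNset ?mule0 //= => /eqP; rewrite gt_eqF // site_gt0.
Qed.

Lemma jump_measure_fin :
  (\int[jump_measure]_(y in punctured) (Num.min 1 (y ^+ 2))%:E < +oo)%E.
Proof.
have m : measurable_fun setT (fun y : measurableTypeR R => Num.min 1 (y ^+ 2)).
  by apply: measurable_minr.
have b k : `|weight k * Num.min 1 (site k ^+ 2)| <= 1 * 2 ^- k :> R.
  have s1 := site_ge1 k; have s2 : 1 <= site k ^+ 2 :> R by rewrite exprn_ege1.
  rewrite min_l // mulr1 mul1r gtr0_norm ?weight_gt0 //.
  by rewrite /weight lef_pV2 ?posrE ?exprn_gt0 // ler_weXn2l ?ler1n.
have /integrableP[_] := jump_measure_integrable m b.
have m' : measurable_fun punctured (fun y => (Num.min 1 (y ^+ 2))%:E : \bar R).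
  by apply/measurable_EFinP; exact: measurable_funTS.
apply: le_lt_trans; apply: ge0_le_integral => //.
- by move=> y _; rewrite lee_fin le_min ler01 sqr_ge0.
- exact: measurableT_comp.
- by move=> y _; rewrite /= lee_fin ler_norm.
Qed.

Definition levy : levy_operator R :=
  @LevyOperator R 0 0 jump_measure (lexx 0) jump_measure0 jump_measure_fin.

End LevyMeasure.

(** * Lebesgue integrals on the line *)
Section Lebesgue.
Context {R : realType}.
Local Notation mu := (@lebesgue_measure R).
Implicit Types f : R -> R.

Lemma translate_lebesgue_measure (a : R) (A : set R) : measurable A ->
  pushforward mu (fun x : R => (x + a : measurableTypeR R)) A = mu A.
Proof.
move=> mA; apply/esym/lebesgue_measure_unique => //=.
  exact: measurable_funD.
move=> _ _ [[b c]] _ <-.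
rewrite /pushforward.
have -> : (fun x : R => x + a) @^-1` `]b, c]%classic = `]b - a, c - a]%classic.
  by apply/seteqP; split => x /=; rewrite !in_itv /= ltrBlDr lerBrDr.
rewrite !lebesgue_measure_itv /= !lte_fin ltrD2r.
by case: (b < c) => //; rewrite -!EFinD; congr EFin; ring.
Qed.

Let mtrans (a : R) : measurable_fun setT (fun x : measurableTypeR R => (x + a : measurableTypeR R)).
Proof. exact: measurable_funD. Qed.

Lemma ge0_integral_translate (a : R) (f : R -> \bar R) :
  measurable_fun [set: R] f -> (forall x, 0 <= f x)%E ->
  (\int[mu]_x f (x + a)%R = \int[mu]_x f x)%E.
Proof.
move=> mf f0.
rewrite -[LHS](@ge0_integral_pushforward _ _ _ _ R _ (mtrans a) mu setT f) //.
by apply: eq_measure_integral => //= A mA _; exact: translate_lebesgue_measure.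
Qed.

Lemma Rintegral_translate (a : R) f : measurable_fun setT f ->
  Rintegral mu setT (fun x => f (x + a)) = Rintegral mu setT f.
Proof.
move=> mf; have mf' : measurable_fun setT (EFin \o f) by exact/measurable_EFinP.
rewrite /Rintegral; congr fine; rewrite [LHS]integralE [RHS]integralE.
have -> : (fun x => (f (x + a))%:E) = (EFin \o f) \o (fun x => x + a) by [].
rewrite funepos_comp funeneg_comp; congr (_ - _)%E.
  by rewrite -[RHS](@ge0_integral_translate a) //; exact: measurable_funepos.
by rewrite -[RHS](@ge0_integral_translate a) //; exact: measurable_funeneg.
Qed.

Lemma integrable_oneDsqrV : mu.-integrable setT (EFin \o (fun t : R => (oneDsqr t)^-1)).
Proof.
have p (t : R) : 0 <= (oneDsqr t)^-1 by rewrite invr_ge0 addr_ge0 // sqr_ge0.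
have c : continuous (fun t : R => (oneDsqr t)^-1) by exact: continuous_oneDsqrV.
apply/integrableP; split.
  by apply/measurable_EFinP; exact: continuous_measurable_fun.
under eq_integral do rewrite /= ger0_norm //.
rewrite ge0_symfun_integralT //; last by move=> x; rewrite /oneDsqr /= sqrrN.
rewrite (_ : [set x | _] = `[0, +oo[%classic); last first.
  by apply/seteqP; split => x/=; rewrite in_itv/= andbT.
by rewrite integral0y_oneDsqr -EFinM ltry.
Qed.

Lemma oneDsqr_pos (t : R) : 0 < oneDsqr t.
Proof. by rewrite ltr_wpDr // sqr_ge0. Qed.

Lemma oneDsqr_nneg (t : R) : 0 <= oneDsqr t.
Proof. exact: ltW (oneDsqr_pos t). Qed.

(** Peetre's inequality, which moves a polynomial weight from [t] to [y] at the
    cost of the same weight at [y - t]. *)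
Lemma oneDsqr_peetre (y t : R) : oneDsqr t <= 2 * oneDsqr y * oneDsqr (y - t).
Proof.
have H (s : R) : 1 + (y - s) ^+ 2 <= 2 * (1 + y ^+ 2) * (1 + s ^+ 2).
  have := sqr_ge0 (y + s); have := mulr_ge0 (sqr_ge0 y) (sqr_ge0 s).
  rewrite !expr2; nra.
have e : y - (y - t) = t by ring.
by have := H (y - t); rewrite e.
Qed.

Definition integral_oneDsqrV : R := Rintegral mu setT (fun t => (oneDsqr t)^-1).

(** The constant [c] is kept in the second bound, where it provides the geometric
    decay that [integral_series] requires. *)
Lemma integrable_dominated f c : measurable_fun setT f ->
  (forall t, `|f t| <= c * (oneDsqr t)^-1) ->
  mu.-integrable setT (EFin \o f) /\
  (\int[mu]_t `|(f t)%:E| <= (c * integral_oneDsqrV)%:E)%E.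
Proof.
move=> mf fc.
have mf' : measurable_fun setT (EFin \o f) by exact/measurable_EFinP.
have i1 := integrable_oneDsqrV.
have i2 : mu.-integrable setT (EFin \o (fun t : R => c * (oneDsqr t)^-1)).
  pose u := fun t : R => (oneDsqr t)^-1.
  have -> : EFin \o (fun t : R => c * (oneDsqr t)^-1) =
    (fun t => (c%:E * (u t)%:E)%E) by [].
  exact: integrableZl.
have b : (\int[mu]_t `|(f t)%:E| <= (c * integral_oneDsqrV)%:E)%E.
  rewrite /integral_oneDsqrV -RintegralZl //.
  rewrite fineK; last exact: integrable_fin_num.
  apply: ge0_le_integral => //.
  - exact: measurableT_comp.
  - exact: measurable_int i2.
  - by move=> t _; rewrite /= lee_fin.
split=> //; apply/integrableP; split => //.
by apply: le_lt_trans b _; rewrite ltry.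
Qed.

Lemma Rintegral_bound f c : measurable_fun setT f ->
  (forall t, `|f t| <= c * (oneDsqr t)^-1) ->
  `|Rintegral mu setT f| <= c * integral_oneDsqrV.
Proof.
move=> mf fc; have [i b] := integrable_dominated mf fc.
rewrite -lee_fin EFin_normr_Rintegral //; apply: le_trans b.
by apply: le_abse_integral => //; exact/measurable_EFinP.
Qed.

Lemma integral_oneDsqrV_ge0 : 0 <= integral_oneDsqrV.
Proof. by apply: Rintegral_ge0 => t _; rewrite invr_ge0 ltW // oneDsqr_pos. Qed.

End Lebesgue.

(** * Convolution of balanced functions *)
Section Balanced.
Context {R : realType}.
Local Notation mu := (@lebesgue_measure R).

Definition rapidly_decreasing (f : R -> R) : Prop :=
  continuous f /\
  forall m, exists2 C, 0 <= C & forall t, `|f t| * oneDsqr t ^+ m <= C.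

(** The properties of the harmonic function that survive convolution with
    rapidly decreasing functions: polynomial growth, and the identity
    [sum_k w_k h (t + y_k) = h t] with geometric control of its terms. The
    control does not follow from the growth bound, since the series of
    [w_k y_k ^ e] diverges for every [e > 0]. *)
Definition balanced (m : nat) (h : R -> R) : Prop :=
  [/\ continuous h,
    exists2 c, 0 <= c & forall t, `|h t| <= c * oneDsqr t ^+ m,
    exists2 c, 0 <= c & forall k t,
      `|weight k * h (t + site k)| <= c * 2 ^- k * oneDsqr t ^+ m &
    forall t, (fun n => \sum_(k < n) weight k * h (t + site k)) @ \oo --> h t].

Lemma rapidly_decreasing_sub f m : rapidly_decreasing f ->
  exists2 C, 0 <= C & forall y t, `|f (y - t)| * oneDsqr t ^+ m <= C * oneDsqr y ^+ m.
Proof.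
move=> [_ /(_ m)[C C0 fC]]; exists (2 ^+ m * C); first by rewrite mulr_ge0 ?exprn_ge0.
move=> y t.
have h : oneDsqr t ^+ m <= (2 * oneDsqr y * oneDsqr (y - t)) ^+ m.
  by rewrite lerXn2r ?oneDsqr_peetre ?nnegrE ?mulr_ge0 ?oneDsqr_nneg.
apply: le_trans (_ : `|f (y - t)| * (2 * oneDsqr y * oneDsqr (y - t)) ^+ m <= _).
  by rewrite ler_wpM2l.
by rewrite [leRHS]mulrAC !exprMn [leLHS]mulrCA ler_wpM2l ?mulr_ge0 ?exprn_ge0 ?oneDsqr_nneg //.
Qed.

(** The form in which the decay of [psi] is used: against a weight of order
    [m], the product is dominated by an integrable function, locally uniformly
    in [y]. *)
Lemma product_dominated (psi : R -> R) m : rapidly_decreasing psi ->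
  exists2 C, 0 <= C & forall (u : R -> R) c y t, 0 <= c ->
    `|u t| <= c * oneDsqr t ^+ m ->
    `|u t * psi (y - t)| <= c * C * oneDsqr y ^+ m.+1 * (oneDsqr t)^-1.
Proof.
move=> /(rapidly_decreasing_sub m.+1)[C C0 pC]; exists C => // u c y t c0 ut.
rewrite ler_pdivlMr ?oneDsqr_pos // normrM.
apply: le_trans (_ : c * (oneDsqr t ^+ m * `|psi (y - t)|) * oneDsqr t <= _).
  rewrite ler_wpM2r ?oneDsqr_nneg // mulrA ler_wpM2r //.
have -> : c * (oneDsqr t ^+ m * `|psi (y - t)|) * oneDsqr t
   = c * (`|psi (y - t)| * oneDsqr t ^+ m.+1) by rewrite exprSr; ring.
by rewrite -[leRHS]mulrA ler_wpM2l.
Qed.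

(** Convolution of real functions, written with the argument that occurs when
    the distribution [h] is tested against [psi (y - .)]. *)
Definition rconv (h psi : R -> R) (y : R) : R :=
  Rintegral mu setT (fun t => h t * psi (y - t)).

Lemma continuous_flip (psi : R -> R) (y : R) : continuous psi ->
  continuous (fun t => psi (y - t)).
Proof.
move=> c t; apply: continuous_comp; last exact: c.
by apply: cvgB; [exact: cvg_cst|exact: cvg_id].
Qed.

Lemma measurable_conv (h psi : R -> R) y : continuous h -> continuous psi ->
  measurable_fun setT (fun t => h t * psi (y - t)).
Proof.
move=> ch cp; apply: measurable_funM; apply: continuous_measurable_fun => //.
exact: continuous_flip.
Qed.

Lemma rconv_continuous m h psi : continuous h ->
  (exists2 c, 0 <= c & forall t, `|h t| <= c * oneDsqr t ^+ m) ->
  rapidly_decreasing psi -> continuous (rconv h psi).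
Proof.
move=> ch [c c0 hc] rp y; have cp := rp.1.
have [C C0 pC] := product_dominated m rp.
pose K := c * C * (2 * oneDsqr y * 2) ^+ m.+1.
pose g := fun t : R => K * (oneDsqr t)^-1.
have ig : mu.-integrable setT (EFin \o g).
  pose u := fun t : R => (oneDsqr t)^-1.
  have -> : EFin \o g = (fun t => (K%:E * (u t)%:E)%E) by [].
  by apply: integrableZl => //; exact: integrable_oneDsqrV.
apply: (@continuity_under_integral R _ _ mu (fun y t => h t * psi (y - t)) setT
   measurableT (y - 1) (y + 1) _ _ g ig).
- move=> z _; have := measurable_conv z ch cp.
  by case/integrable_dominated/(_ (fun t => pC h c z t c0 (hc t))).
- apply/aeW => t _ z _ ; apply: cvgM; first exact: cvg_cst.
  apply: continuous_comp; last exact: cp.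
  by apply: cvgB; [exact: cvg_id|exact: cvg_cst].
- move=> z; rewrite /= in_itv /= => /andP[z1 z2]; apply/aeW => t _.
  apply: le_trans (pC h c z t c0 (hc t)) _.
  rewrite ler_wpM2r ?invr_ge0 ?oneDsqr_nneg // ler_wpM2l ?mulr_ge0 //.
  rewrite lerXn2r ?nnegrE ?mulr_ge0 ?oneDsqr_nneg //.
  apply: le_trans (oneDsqr_peetre y z) _.
  rewrite ler_wpM2l ?mulr_ge0 ?oneDsqr_nneg // /oneDsqr.
  nra.
- by rewrite inE /= in_itv /=; apply/andP; split; lra.
Qed.

(** After the translation [t := t + site k] in the integral, the [k]-th shifted
    value of the convolution is the convolution of the [k]-th term for [h]; the
    terms decay geometrically in [L^1], so that the series can be integrated
    term by term. *)
Lemma balanced_rconv m h psi : balanced m h -> rapidly_decreasing psi ->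
  balanced m.+1 (rconv h psi).
Proof.
move=> [ch hb [c c0 hw] hs] rp; have cp := rp.1.
have [C C0 pC] := product_dominated m rp.
have mc (u : R -> R) (y : R) : continuous u ->
    measurable_fun setT (fun t : R => u t * psi (y - t)).
  by move=> cu; exact: measurable_conv.
have W0 := @integral_oneDsqrV_ge0 R.
have cw k : continuous (fun t => weight k * h (t + site k)).
  move=> t; apply: cvgM; first exact: cvg_cst.
  apply: continuous_comp; last exact: ch.
  by apply: cvgD; [exact: cvg_id|exact: cvg_cst].
have e k y : weight k * rconv h psi (y + site k) =
    Rintegral mu setT (fun t => weight k * h (t + site k) * psi (y - t)).
  rewrite /rconv -(Rintegral_translate (site k)); last exact: mc.
  have ck : continuous (fun t => h (t + site k)).
    move=> t; apply: continuous_comp; last exact: ch.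
    by apply: cvgD; [exact: cvg_id|exact: cvg_cst].
  have ee : (fun t => h (t + site k) * psi (y + site k - (t + site k))) =
      (fun t => h (t + site k) * psi (y - t)).
    by apply/funext => t; congr (_ * psi _); ring.
  rewrite ee -RintegralZl //; first by apply: eq_Rintegral => t _; rewrite mulrA.
  apply: (integrable_dominated (c := (weight k)^-1 * (c * 2 ^- k) * C * oneDsqr y ^+ m.+1) _ _).1.
    exact: (mc (fun t => h (t + site k))).
  move=> t; apply: (pC (fun t => h (t + site k))).
    by rewrite !mulr_ge0 // ?invr_ge0 ?exprn_ge0 // ltW // weight_gt0.
  have w0 := @weight_gt0 R k.
  have := hw k t; rewrite normrM (gtr0_norm w0).
  by rewrite -[_ * _ ^+ m in X in _ -> X]mulrA ler_pdivlMl.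
split.
- exact: rconv_continuous hb rp.
- have [c' c'0 hc'] := hb; exists (c' * C * integral_oneDsqrV).
    by rewrite !mulr_ge0.
  move=> y; rewrite mulrAC; apply: Rintegral_bound; first exact: mc.
  by move=> t; exact: pC.
- exists (c * C * integral_oneDsqrV); first by rewrite !mulr_ge0.
  move=> k y; rewrite e.
  have -> : c * C * integral_oneDsqrV * 2 ^- k * oneDsqr y ^+ m.+1 =
    (c * 2 ^- k) * C * oneDsqr y ^+ m.+1 * integral_oneDsqrV by ring.
  apply: Rintegral_bound; first exact: (mc (fun t => weight k * h (t + site k))).
  move=> t; apply: (pC (fun t => weight k * h (t + site k))) => //.
  by rewrite mulr_ge0 // invr_ge0 exprn_ge0.
- move=> y.
  have [||//|_] := @integral_series R _ _ mu
    (fun k t => weight k * h (t + site k) * psi (y - t))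
    (fun t => h t * psi (y - t))
    (c * C * oneDsqr y ^+ m.+1 * integral_oneDsqrV).
  + by move=> k; exact: (mc (fun t => weight k * h (t + site k))).
  + move=> k; have [|_] := @integrable_dominated R
      (fun t => weight k * h (t + site k) * psi (y - t))
      ((c * 2 ^- k) * C * oneDsqr y ^+ m.+1)
      (mc (fun t => weight k * h (t + site k)) y (cw k)).
      move=> t; apply: (pC (fun t => weight k * h (t + site k))) => //.
      by rewrite mulr_ge0 // invr_ge0 exprn_ge0.
    by congr (_ <= _)%E; congr EFin; ring.
  + move=> t; under eq_fun do rewrite -mulr_suml.
    by apply: cvgM; [exact: hs|exact: cvg_cst].
  + move=> L; have -> // : (fun n => \sum_(k < n) weight k * rconv h psi (y + site k)) =
      (fun n => \sum_(k < n) Rintegral mu setT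
         (fun t => weight k * h (t + site k) * psi (y - t))).
    by apply/funext => n; apply: eq_bigr => k _; rewrite e.
Qed.

(** A limit of finite sums rather than an integral against [jump_measure], since
    the exchange with Lebesgue integrals is done on finite parts. *)
Definition is_jump_sum (f K : R -> R) : Prop :=
  forall u, (fun n => \sum_(k < n) weight k * (f (u + site k) - f u)) @ \oo --> K u.

Lemma cvg_sum_weight : (fun n => \sum_(k < n) weight k : R) @ \oo --> (1 : R).
Proof.
have h : (fun n => (2 : R) ^- n) @ \oo --> (0 : R).
  under eq_fun do rewrite -exprVn.
  by apply: cvg_expr; rewrite gtr0_norm ?invr_gt0 // invf_lt1 // ltr1n.
under eq_fun do rewrite sum_weight.
have : (fun n => 1 - (2 : R) ^- n) @ \oo --> (1 - 0 : R).
  by apply: cvgB => //; exact: cvg_cst.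
by rewrite subr0.
Qed.

(** The jump operator is moved from [phi] to [G]. Integrating the series for [K]
    termwise gives the jump sum of [rconv G phi] at [x], which vanishes because
    [rconv G phi] is balanced and the weights add up to [1]. For the termwise
    integration, the shift in [phi (x - y + site k)] is first transferred to [G],
    where the geometric control is available. *)
Lemma jump_convolution m G phi K x : balanced m G -> rapidly_decreasing phi ->
  is_jump_sum phi K ->
  mu.-integrable setT (EFin \o (fun y => K (x - y) * G y)) /\
  Rintegral mu setT (fun y => K (x - y) * G y) = 0.
Proof.
move=> bG rp Kf; have [cG [c' c'0 Gc'] [c c0 Gw] _] := bG; have cp := rp.1.
have [C C0 pC] := product_dominated m rp.
have W0 := @integral_oneDsqrV_ge0 R.
have ctr (f : R -> R) a : continuous f -> continuous (fun t => f (t + a)).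
  move=> cf t; apply: continuous_comp; last exact: cf.
  by apply: cvgD; [exact: cvg_id|exact: cvg_cst].
have w0 k := @weight_gt0 R k.
pose f k y := weight k * (phi (x - y + site k) - phi (x - y)) * G y.
pose f1 k y := weight k * (G y * phi (x + site k - y)).
pose f2 k y := weight k * (G y * phi (x - y)).
have fE k : f k = fun y => f1 k y - f2 k y.
  by apply/funext => y; rewrite /f /f1 /f2 [x + _ - y]addrAC; ring.
have m1 k : measurable_fun setT (f1 k).
  by apply: measurable_funM => //; exact: measurable_conv.
have m2 k : measurable_fun setT (f2 k).
  by apply: measurable_funM => //; exact: measurable_conv.
pose D := oneDsqr x ^+ m.+1 * integral_oneDsqrV : R.
have D0 : 0 <= D by rewrite mulr_ge0 // exprn_ge0 // ltW // oneDsqr_pos.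
have b1 k : (\int[mu]_y `|(f1 k y)%:E| <= (c * C * D * 2 ^- k)%:E)%E.
  rewrite -(ge0_integral_translate (site k)) //; last first.
    by apply: measurableT_comp => //; exact/measurable_EFinP.
  have -> : (fun y => `|(f1 k (y + site k))%:E|%E) =
     (fun y => `|(weight k * G (y + site k) * phi (x - y))%:E|%E).
    apply/funext => y; rewrite /f1 mulrA; congr (`|(_ * phi _)%:E|%E); ring.
  have [||_] := @integrable_dominated R
      (fun y => weight k * G (y + site k) * phi (x - y))
      ((c * 2 ^- k) * C * oneDsqr x ^+ m.+1).
  - apply: measurable_conv => // t; apply: cvgM; first exact: cvg_cst.
    exact: ctr.
  - move=> t; apply: (pC (fun y => weight k * G (y + site k))) => //.
    by rewrite mulr_ge0 // invr_ge0 exprn_ge0.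
  - by congr (_ <= _)%E; congr EFin; rewrite /D; ring.
have b2 k : (\int[mu]_y `|(f2 k y)%:E| <= (c' * C * D * 2 ^- k)%:E)%E.
  have [|_ h] := @integrable_dominated R (f2 k)
      ((c' * 2 ^- k) * C * oneDsqr x ^+ m.+1) (m2 k).
  - move=> t; rewrite /f2 mulrA.
    apply: (pC (fun y => weight k * G y)); first by rewrite mulr_ge0 // invr_ge0 exprn_ge0.
    rewrite normrM gtr0_norm // mulrAC [_ * 2 ^- k]mulrC ler_pM ?(ltW (w0 k)) //.
    by rewrite /weight lef_pV2 ?posrE ?exprn_gt0 // ler_weXn2l ?ler1n.
  - by apply: le_trans h _; rewrite lee_fin /D le_eqVlt; apply/orP; left; apply/eqP; ring.
have i1 k : mu.-integrable setT (EFin \o f1 k).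
  apply/integrableP; split; first by apply/measurable_EFinP; exact: m1.
  by apply: le_lt_trans (b1 k) _; rewrite ltry.
have i2 k : mu.-integrable setT (EFin \o f2 k).
  apply/integrableP; split; first by apply/measurable_EFinP; exact: m2.
  by apply: le_lt_trans (b2 k) _; rewrite ltry.
have a1 k : measurable_fun setT (fun y => `|(f1 k y)%:E|%E).
  by apply: measurableT_comp => //; apply/measurable_EFinP; exact: m1.
have a2 k : measurable_fun setT (fun y => `|(f2 k y)%:E|%E).
  by apply: measurableT_comp => //; apply/measurable_EFinP; exact: m2.
have mf k : measurable_fun setT (f k).
  by rewrite fE; exact: measurable_funB.
have [||//|iK lK] := @integral_series R _ _ mu f (fun y => K (x - y) * G y)
   ((c + c') * C * D).
- exact: mf.
- move=> k; apply: le_trans (_ : (\int[mu]_y (`|(f1 k y)%:E| + `|(f2 k y)%:E|) <= _)%E).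
    apply: ge0_le_integral => //.
    + by apply: measurableT_comp => //; apply/measurable_EFinP; exact: mf.
    + by apply: emeasurable_funD; [exact: a1|exact: a2].
    + by move=> y _; rewrite fE /= lee_fin ler_normB.
  rewrite ge0_integralD //; [|exact: a1|exact: a2].
  rewrite !mulrDl EFinD; exact: leeD.
- move=> y; have -> : (fun n => \sum_(k < n) f k y) =
      (fun n => (\sum_(k < n) weight k * (phi (x - y + site k) - phi (x - y))) * G y).
    by apply/funext => n; rewrite mulr_suml.
  by apply: cvgM; [exact: Kf|exact: cvg_cst].
split => //.
have Rf k : Rintegral mu setT (f k) =
    weight k * rconv G phi (x + site k) - weight k * rconv G phi x.
  rewrite fE RintegralB // /f1 /f2 /rconv !RintegralZl //.
  - by case: (integrable_dominated (measurable_conv x cG cp)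
      (fun t => pC G c' x t c'0 (Gc' t))).
  - by case: (integrable_dominated (measurable_conv (x + site k) cG cp)
      (fun t => pC G c' (x + site k) t c'0 (Gc' t))).
have [_ _ _ /(_ x) l1] := balanced_rconv bG rp.
have l2 : (fun n => \sum_(k < n) Rintegral mu setT (f k)) @ \oo -->
    rconv G phi x - 1 * rconv G phi x.
  under eq_fun do under eq_bigr do rewrite Rf.
  under eq_fun do rewrite sumrB -mulr_suml.
  apply: cvgB => //; apply: cvgM; [exact: cvg_sum_weight|exact: cvg_cst].
by move/cvg_lim : lK => <- //; move/cvg_lim : l2 => -> //; rewrite mul1r subrr.
Qed.

End Balanced.

(** * Levy operator of the discrete measure *)
Section JumpOperator.
Context {R : realType}.
Local Notation punctured := ([set~ 0] : set (measurableTypeR R)).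
Local Notation nu := (@jump_measure R).

Lemma weight_le_geometric k : weight k <= 2 ^- k :> R.
Proof. by rewrite /weight lef_pV2 ?posrE ?exprn_gt0 // ler_weXn2l ?ler1n. Qed.

Lemma weighted_bound (u : nat -> R) M : (forall k, `|u k| <= M) ->
  forall k, `|weight k * u k| <= M * 2 ^- k.
Proof.
move=> uM k; rewrite normrM gtr0_norm ?weight_gt0 // mulrC.
by rewrite ler_pM ?uM ?weight_le_geometric // ltW // weight_gt0.
Qed.

Lemma ball_site k : \1_(ball (0 : R) 1) (site k) = 0 :> R.
Proof.
rewrite indicE memNset //= /ball /= sub0r normrN gtr0_norm ?site_gt0 //.
by apply/negP; rewrite -leNgt site_ge1.
Qed.

Lemma ball_opp_site k : \1_(ball (0 : R) 1) (- site k) = 0 :> R.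
Proof.
rewrite indicE memNset //= /ball /= sub0r opprK gtr0_norm ?site_gt0 //.
by apply/negP; rewrite -leNgt site_ge1.
Qed.

Lemma measurable_levy_integrand (u : R -> R) x : continuous u ->
  measurable_fun setT (levy_integrand u x).
Proof.
move=> cu; apply: measurable_funB.
  apply: measurable_funB; last exact: measurable_cst.
  apply: continuous_measurable_fun => y; apply: continuous_comp; last exact: cu.
  by apply: cvgD; [exact: cvg_cst|exact: cvg_id].
apply: measurable_funM; last exact: measurable_cst.
apply: measurable_funM => //; apply: measurable_indic.
exact: measurable_ball.
Qed.

Lemma levy_integrand_site (u : R -> R) x k :
  levy_integrand u x (site k) = u (x + site k) - u x.
Proof. by rewrite /levy_integrand ball_site !mul0r subr0. Qed.

(** All jumps have size at least [1], hence the compensator never acts. *)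
Lemma levy_apply_jump (u : R -> R) x c l : continuous u ->
  (forall k, `|weight k * (u (x + site k) - u x)| <= c * 2 ^- k) ->
  (fun n => \sum_(k < n) weight k * (u (x + site k) - u x)) @ \oo --> l ->
  nu.-integrable punctured (EFin \o levy_integrand u x) /\
  levy_apply levy u x = l.
Proof.
move=> cu uc ul; have m := measurable_levy_integrand x cu.
have b k : `|weight k * levy_integrand u x (site k)| <= c * 2 ^- k.
  by rewrite levy_integrand_site.
split; first exact: jump_measure_integrable m b.
rewrite /levy_apply /= !mul0r !add0r; apply: jump_measure_Rintegral m b _.
by under eq_fun do under eq_bigr do rewrite levy_integrand_site.
Qed.

Lemma levy_apply_dual (u : R -> R) M l : continuous u ->
  (forall y, `|u y| <= M) ->
  (fun n => \sum_(k < n) weight k * (u (- site k) - u 0)) @ \oo --> l ->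
  levy_apply (levy_dual levy) u 0 = l.
Proof.
move=> cu uM ul; have m := measurable_levy_integrand 0 cu.
have e k : levy_integrand u 0 (- site k) = u (- site k) - u 0.
  by rewrite /levy_integrand ball_opp_site !mul0r subr0 add0r.
pose v y := levy_integrand u 0 (- y).
have mv : measurable_fun setT v.
  by apply: measurableT_comp m _; exact: oppr_measurable.
have b k : `|weight k * v (site k)| <= (2 * M) * 2 ^- k.
  apply: (@weighted_bound (fun k => v (site k))) => {}k; rewrite /v e mulr2n mulrDl mul1r.
  by apply: le_trans (ler_normB _ _) _; rewrite lerD.
rewrite /levy_apply /= oppr0 !mul0r !add0r /Rintegral.
rewrite /reflect_measure integral_pushforward.
- rewrite preimage_oppT_setC10; apply: (jump_measure_Rintegral mv b).
  by under eq_fun do under eq_bigr do rewrite /v e.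
- exact: measurable_oppT.
- exact/measurable_EFinP.
- by rewrite preimage_oppT_setC10; exact: jump_measure_integrable mv b.
- by apply: measurableC; exact: measurable_set1.
Qed.

Lemma levy_apply_balanced m (h : R -> R) x : balanced m h ->
  nu.-integrable punctured (EFin \o levy_integrand h x) /\
  levy_apply levy h x = 0.
Proof.
move=> [ch _ [c c0 hw] hs].
apply: (@levy_apply_jump _ _ (c * oneDsqr x ^+ m + `|h x|)) => // [k|].
  rewrite mulrBr mulrDl; apply: le_trans (ler_normB _ _) _; apply: lerD.
    by rewrite mulrAC; exact: hw.
  exact: (@weighted_bound (fun=> h x)).
under eq_fun do under eq_bigr do rewrite mulrBr.
under eq_fun do rewrite sumrB -mulr_suml.
have : (fun n => \sum_(k < n) weight k * h (x + site k)
   - (\sum_(k < n) weight k) * h x) @ \oo --> h x - 1 * h x.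
  by apply: cvgB; [exact: hs|apply: cvgM; [exact: cvg_sum_weight|exact: cvg_cst]].
by rewrite mul1r subrr.
Qed.

End JumpOperator.

(** * Zeros of the characteristic exponent *)
Section NotConcentrated.
Context {R : realType}.

(** Reduction modulo [2 pi] to an [s] with [0 <= s < 2 pi], where
    [cos s = 1 - 2 sin (s / 2) ^ 2] and [sin (s / 2)] is positive for [s > 0]. *)
Lemma cos_eq1 (t : R) : cos t = 1 -> exists n : nat, `|t| = (pi *+ 2) *+ n.
Proof.
move=> ct; have p0 : 0 < pi *+ 2 :> R by rewrite mulr2n addr_gt0 // pi_gt0.
pose n := Num.truncn (`|t| / (pi *+ 2)); exists n.
have q0 : 0 <= `|t| / (pi *+ 2) by rewrite divr_ge0 // ltW.
have /andP[n1 n2] := truncn_itv q0; rewrite -/n in n1 n2.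
rewrite ler_pdivlMr // in n1; rewrite ltr_pdivrMr // in n2.
pose s := `|t| - (pi *+ 2) *+ n.
have s0 : 0 <= s by rewrite subr_ge0 -mulr_natl.
have s1 : s < pi *+ 2.
  by rewrite ltrBlDr -[X in _ < X]mulrS -mulr_natl.
have ts : `|t| = s + (pi *+ 2) *+ n by rewrite subrK.
have cs : cos s = 1 by rewrite -ct -(cos_norm t) ts (periodicn (@cosD2pi R)).
have ss : sin (s / 2) = 0.
  have s2 : (s / 2) *+ 2 = s by rewrite -mulr_natr divfK // pnatr_eq0.
  have := cos_mulr2n (s / 2); rewrite s2 cs cos2sin2.
  by rewrite mulr2n => h; apply/eqP; rewrite -sqrf_eq0; apply/eqP; lra.
rewrite ts; suff -> : s = 0 by rewrite add0r.
apply/eqP; apply: contraTT isT => sn0; have {s0} s0 : 0 < s by rewrite lt_neqAle eq_sym sn0.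
have : 0 < sin (s / 2).
  by apply: sin_gt0_pi; rewrite divr_gt0 //= ltr_pdivrMr // mulr_natr.
by rewrite ss ltxx.
Qed.

Lemma odd_power_two_square (a b e f : nat) :
  odd (e + f) -> (a ^ 2 * 2 ^ e = b ^ 2 * 2 ^ f)%N -> a = 0%N.
Proof.
move=> oef; have [//|a0 E] := posnP a.
have b0 : (0 < b)%N.
  rewrite lt0n; apply: contra_eq_neq E => ->.
  by rewrite exp0n // mul0n -lt0n muln_gt0 !expn_gt0 a0.
have := congr1 (logn 2) E.
have l2 : logn 2 2 = 1%N by [].
rewrite !lognM ?expn_gt0 ?a0 ?b0 // !lognX l2 !muln1 => /(congr1 odd).
move: oef; rewrite !oddD !addbb.
by case: (odd e); case: (odd f).
Qed.

Lemma site_sqr n : site n ^+ 2 = 2 ^+ (2 * (n + 3) ^ 3 + n) :> R.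
Proof.
have e : (Num.sqrt (2 : R) ^+ n) ^+ 2 = 2 ^+ n.
  by rewrite -exprM mulnC exprM sqr_sqrtr.
by rewrite /site exprMn e -exprM -exprD mulnC.
Qed.

(** Squaring a rational dependence gives [m ^ 2 * 2 ^ e = n ^ 2 * 2 ^ f] with
    [e + f] odd, which the 2-adic valuation excludes. *)
Lemma site_incommensurable (xi : R) m n :
  `|xi| * site 0 = (pi *+ 2) *+ m -> `|xi| * site 1 = (pi *+ 2) *+ n -> xi = 0.
Proof.
move=> hm hn; have p0 : pi *+ 2 != 0 :> R by rewrite gt_eqF // mulr2n addr_gt0 // pi_gt0.
have [/normr0_eq0 //|x0] := eqVneq `|xi| 0.
have E : m%:R * site 1 = n%:R * site 0 :> R.
  move: hm hn p0; move: (site 0) (site 1) (pi *+ 2) => a b p hm hn p0.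
  apply: (mulfI p0); rewrite mulrA [RHS]mulrA (mulr_natr p m) (mulr_natr p n).
  by rewrite -hm -hn mulrAC.
have [e oe se] : exists2 e, odd e & site 1 ^+ 2 = 2 ^+ e :> R.
  by exists (2 * (1 + 3) ^ 3 + 1)%N; [rewrite oddD oddM|exact: (site_sqr 1)].
have [f ef sf] : exists2 f, ~~ odd f & site 0 ^+ 2 = 2 ^+ f :> R.
  by exists (2 * (0 + 3) ^ 3 + 0)%N; [rewrite oddD oddM|exact: (site_sqr 0)].
have {}E : (m ^ 2 * 2 ^ e = n ^ 2 * 2 ^ f)%N.
  apply/eqP; rewrite -(eqr_nat R) (natrM _ (m ^ 2)) (natrM _ (n ^ 2)) !natrX -se -sf -!exprMn.
  by rewrite E.
have m0 : m = 0%N.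
  by apply: odd_power_two_square E; rewrite oddD oe (negbTE ef).
move: hm; rewrite m0 mulr0n => /eqP; rewrite mulf_eq0 (negbTE x0).
by rewrite gt_eqF // site_gt0.
Qed.

(** The real part of the exponent is the sum of [w_k (1 - cos (xi y_k))], a series
    of nonnegative terms; if it vanishes, then every [xi y_k] is a multiple of
    [2 pi], against incommensurability. *)
Lemma levy_not_concentrated :
  not_concentrated_on_proper_closed_subgroup (@levy R).
Proof.
move=> xi; rewrite /levy_exponent => /(congr1 (@complex.Re R)) /=.
rewrite !mul0r mulr0 !subr0 add0r.
set f := re_part _.
have -> : f = fun y : R => 1 - cos (xi * y).
  by apply/funext => y; rewrite /f /re_part /= mul0r mul1r ?subr0 ?addr0 ?oppr0 ?addr0.
have mf : measurable_fun setT (fun y : R => 1 - cos (xi * y)).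
  apply: continuous_measurable_fun => y; apply: cvgB; first exact: cvg_cst.
  apply: continuous_comp; last exact: continuous_cos.
  by apply: cvgM; [exact: cvg_cst|exact: cvg_id].
have c0 y : 0 <= 1 - cos (xi * y) by rewrite subr_ge0 cos_le1.
have b k : `|weight k * (1 - cos (xi * site k))| <= 2 * 2 ^- k.
  apply: (@weighted_bound _ (fun k => 1 - cos (xi * site k))) => {}k.
  by rewrite ger0_norm //; have := cos_geN1 (xi * site k); lra.
have /cvg_ex[/= l hl] := geometric_dominated_cvg b.
rewrite (jump_measure_Rintegral mf b hl) => l0; rewrite l0 in hl.
have z k : cos (xi * site k) = 1.
  have t0 j : 0 <= weight j * (1 - cos (xi * site j)).
    by rewrite mulr_ge0 // ltW // weight_gt0.
  have : weight k * (1 - cos (xi * site k)) <= 0.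
    rewrite -(cvg_lim _ hl) //.
    apply: (@le_trans _ _ (\sum_(j < k.+1) weight j * (1 - cos (xi * site j)))).
      by rewrite big_ord_recr /= lerDr sumr_ge0.
    apply: (@nondecreasing_cvgn_le _ (fun n => \sum_(j < n) weight j * (1 - cos (xi * site j)))).
      apply/nondecreasing_seqP => n.
      by rewrite big_ord_recr /= lerDl.
    by apply/cvg_ex; exists 0.
  rewrite pmulr_rle0 ?weight_gt0 // => h; apply/eqP; rewrite eq_le cos_le1 /=; lra.
have [m hm] := cos_eq1 (z 0%N); have [n hn] := cos_eq1 (z 1%N).
rewrite normrM (gtr0_norm (site_gt0 _)) in hm.
rewrite normrM (gtr0_norm (site_gt0 _)) in hn.
exact: site_incommensurable hm hn.
Qed.

End NotConcentrated.

(** * Growth and balance of the harmonic function *)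
Section HarmonicFunction.
Context {R : realType}.
Local Notation h := (harmonic (@bump R)).

Lemma harmonic_bump_smooth : smooth h.
Proof. by apply: harmonic_smooth; [exact: bump_smooth|exact: bump_support]. Qed.

Lemma harmonic_balanced : balanced 1 h.
Proof.
split.
- exact: smooth_continuous harmonic_bump_smooth.
- exists 2 => // t; rewrite expr1 /oneDsqr.
  apply: le_trans (harmonic_linear bump_bound bump_support t) _.
  have : `|t| ^+ 2 = t ^+ 2 by rewrite real_normK ?num_real.
  move=> <-; have := sqr_ge0 (`|t| - 1); rewrite !expr2; nra.
- exists 4 => // k t; rewrite expr1.
  exact: harmonic_jump_bound bump_bound bump_support k t.
- move=> t; apply: cvg_near_cst; exists (Num.truncn `|t|).+2 => // n /= tn.
  case: n tn => // n tn; apply: (sum_harmonic bump_support).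
  have := le_truncn_site t.
  have := @le_site R (Num.truncn `|t|).+1 n tn; lra.
Qed.

(** The [j]-th power of the function grows at most linearly for every [j]; taking
    [j * eps >= 2] leaves a factor [1 / |x|]. *)
Lemma harmonic_growth (eps e : R) : 0 < eps -> 0 < e ->
  exists2 T, 0 < T & forall x, T <= `|x| -> `| `|x| `^ (- eps) * h x| <= e.
Proof.
move=> eps0 e0; pose j := (Num.truncn (2 / eps)).+1.
have j2 : 2 <= eps * j%:R.
  rewrite -ler_pdivrMl // [_ * 2]mulrC; apply: ltW; exact: truncnS_gt.
have ej : 0 < e ^+ j by rewrite exprn_gt0.
pose A : R := amplitude j ^+ j.
have A1 : 1 <= A by rewrite exprn_ege1 // amplitude_ge1.
exists (A + 3 / e ^+ j); first by rewrite addr_gt0 ?divr_gt0 //; lra.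
move=> x Tx; have q0 : 0 < 3 / e ^+ j by rewrite divr_gt0.
have x1 : 1 <= `|x| by lra.
have x0 : 0 < `|x| by lra.
have hj := harmonic_power bump_bound bump_support j x.
rewrite -(@ler_pXn2r R j) ?nnegrE ?(ltW e0) //.
rewrite normrM exprMn ger0_norm ?powR_ge0 //.
rewrite -powR_mulrn ?powR_ge0 // -powRrM mulNr.
apply: le_trans (_ : `|x| ^- 2 * (3 * `|x|) <= _).
  apply: ler_pM; [by rewrite powR_ge0|by rewrite exprn_ge0| |].
    by rewrite -powR_invn // ler_powR // lerN2.
  by rewrite /A in Tx; lra.
have -> : `|x| ^- 2 * (3 * `|x|) = 3 / `|x| by field; rewrite gt_eqF.
rewrite ler_pdivrMr // mulrC -ler_pdivrMr //; lra.
Qed.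

Lemma harmonic_subpower (eps : R) : 0 < eps ->
  (`|x| `^ (- eps) * h x @[x --> +oo] --> (0 : R)) /\
  (`|x| `^ (- eps) * h x @[x --> -oo] --> (0 : R)).
Proof.
move=> eps0; split; apply/cvgrPdist_le => e e0;
  have [T T0 hT] := harmonic_growth eps0 e0; near=> x; rewrite sub0r normrN; apply: hT.
  apply: le_trans (ler_norm x); near: x; apply: nbhs_pinfty_ge; exact: num_real.
rewrite -normrN; apply: le_trans (ler_norm (- x)); rewrite lerNr; near: x.
by apply: nbhs_ninfty_le; exact: num_real.
Unshelve. all: by end_near. Qed.

(** The function coincides with the bump near the origin: it vanishes on
    an interval without being zero. *)
Lemma harmonic_not_polynomial : ~ exists p : {poly R}, forall x, h x = p.[x].
Proof.
move=> [p hp]; have hE x : `|x| <= 5 -> h x = bump x.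
  move=> x5; rewrite (@harmonicE _ _ bump_support 0) //.
  by have := @site0_ge10 R; lra.
suff p0 : p = 0.
  by have := @bump0_neq0 R; rewrite -hE ?normr0 // hp p0 horner0 eqxx.
apply/eqP; apply: contraTT isT => p0.
pose rs := [seq 2 + i.+1%:R^-1 : R | i <- iota 0 (size p)].
suff /(max_poly_roots p0) : all (root p) rs.
  rewrite size_map size_iota ltnn => H; apply: H.
  rewrite map_inj_uniq ?iota_uniq // => i k /addrI /invr_inj /eqP.
  by rewrite eqr_nat => /eqP[].
apply/allP => _ /mapP[i _ ->]; rewrite /root -hp.
have i0 : 0 < i.+1%:R^-1 :> R by rewrite invr_gt0.
have i1 : i.+1%:R^-1 <= 1 :> R by rewrite invf_le1 // ler1n.
move: (i.+1%:R^-1) i0 i1 => v i0 i1.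
have n : `|2 + v| = 2 + v by rewrite ger0_norm //; lra.
rewrite hE; last by rewrite n; lra.
by rewrite bump_support ?eqxx // n; lra.
Qed.

End HarmonicFunction.

(** * Schwartz functions and tempered distributions *)
Section Schwartz.
Context {R : realType}.
Implicit Types (u v w : R -> R) (phi psi : R -> R[i]).
Local Notation normc := ComplexField.Normc.normc.
Local Notation mu := (@lebesgue_measure R).

Lemma normr_Re_le_normc (z : R[i]) : `|complex.Re z| <= normc z.
Proof. by case: z => a b /=; rewrite -sqrtr_sqr ler_sqrt ?lerDl ?addr_ge0 ?sqr_ge0. Qed.

Lemma normr_Im_le_normc (z : R[i]) : `|complex.Im z| <= normc z.
Proof. by case: z => a b /=; rewrite -sqrtr_sqr ler_sqrt ?lerDr ?addr_ge0 ?sqr_ge0. Qed.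

Lemma normc_le_add (a b c : R) : `|a| <= c -> `|b| <= c -> normc (a +i* b)%C <= 2 * c.
Proof.
move=> ac bc /=; have c0 : 0 <= c := le_trans (normr_ge0 a) ac.
rewrite -[leRHS]ger0_norm ?mulr_ge0 // -sqrtr_sqr ler_sqrt ?sqr_ge0 //.
have a2 : `|a| ^+ 2 = a ^+ 2 by rewrite real_normK ?num_real.
have b2 : `|b| ^+ 2 = b ^+ 2 by rewrite real_normK ?num_real.
rewrite -a2 -b2 exprMn.
have : `|a| ^+ 2 <= c ^+ 2 by rewrite lerXn2r.
have : `|b| ^+ 2 <= c ^+ 2 by rewrite lerXn2r.
have : 0 <= c ^+ 2 by rewrite sqr_ge0.
have -> : (2 : R) ^+ 2 = 4 by ring.
lra.
Qed.

Lemma schwartz_seminorm_ub phi m n x : schwartz phi ->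
  `|x| ^+ m * normc (cderiven n phi x) <= schwartz_seminorm m n phi.
Proof. by move=> [_ ub]; apply: ub_le_sup; [exact: ub|exists x]. Qed.

Lemma schwartz_seminorm_ge0 phi m n : schwartz phi -> 0 <= schwartz_seminorm m n phi.
Proof.
move=> sp; apply: le_trans (schwartz_seminorm_ub m n 0 sp).
by rewrite mulr_ge0 ?exprn_ge0 // (le_trans (normr_ge0 _) (normr_Re_le_normc _)).
Qed.

Lemma schwartz_seminorm_le_sum phi N m n : schwartz phi -> (m < N)%N -> (n < N)%N ->
  schwartz_seminorm m n phi <=
  \sum_(m < N) \sum_(n < N) schwartz_seminorm m n phi.
Proof.
move=> sp mN nN.
rewrite (bigD1 (Ordinal mN)) //= (bigD1 (Ordinal nN)) //= -addrA lerDl.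
apply: addr_ge0; first by apply: sumr_ge0 => i _; exact: schwartz_seminorm_ge0.
by apply: sumr_ge0 => i _; apply: sumr_ge0 => j _; exact: schwartz_seminorm_ge0.
Qed.

(** Real and imaginary parts of a Schwartz function are treated alike through
    this domination. *)
Definition part_of phi u := smooth u /\ forall x, `|u x| <= normc (cderiven 0 phi x).

Lemma re_part_of phi : schwartz phi -> part_of phi (re_part phi).
Proof. by move=> [[s _] _]; split => // x; exact: (normr_Re_le_normc (cderiven 0 phi x)). Qed.

Lemma im_part_of phi : schwartz phi -> part_of phi (im_part phi).
Proof. by move=> [[_ s] _]; split => // x; exact: (normr_Im_le_normc (cderiven 0 phi x)). Qed.

Lemma part_seminorm phi u m x : schwartz phi -> part_of phi u ->
  `|x| ^+ m * `|u x| <= schwartz_seminorm m 0 phi.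
Proof.
move=> sp [_ up]; apply: le_trans (schwartz_seminorm_ub m 0 x sp).
by rewrite ler_wpM2l ?exprn_ge0.
Qed.

(** [(1 + t ^ 2) ^ m] is at most [2 ^ m] for [|t| <= 1] and at most
    [2 ^ m |t| ^ (2 m)] otherwise. *)
Lemma part_decay phi u m t : schwartz phi -> part_of phi u ->
  `|u t| * oneDsqr t ^+ m <=
  2 ^+ m * (schwartz_seminorm 0 0 phi + schwartz_seminorm (2 * m) 0 phi).
Proof.
move=> sp pu; have h0 := part_seminorm 0 t sp pu; have hm := part_seminorm (2 * m) t sp pu.
have p0 := schwartz_seminorm_ge0 0 0 sp; have pm := schwartz_seminorm_ge0 (2 * m) 0 sp.
have t2 : `|t| ^+ 2 = t ^+ 2 by rewrite real_normK ?num_real.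
have [t1|t1] := leP (t ^+ 2) 1.
  have h : oneDsqr t ^+ m <= 2 ^+ m.
    by rewrite lerXn2r ?nnegrE ?oneDsqr_nneg // /oneDsqr; lra.
  apply: le_trans (_ : `|u t| * 2 ^+ m <= _); first by rewrite ler_wpM2l.
  rewrite mulrC ler_wpM2l ?exprn_ge0 //; rewrite expr0 mul1r in h0; lra.
have h : oneDsqr t ^+ m <= 2 ^+ m * `|t| ^+ (2 * m).
  rewrite exprM -exprMn lerXn2r ?nnegrE ?oneDsqr_nneg ?mulr_ge0 ?sqr_ge0 //.
  by rewrite t2 /oneDsqr; lra.
apply: le_trans (_ : `|u t| * (2 ^+ m * `|t| ^+ (2 * m)) <= _).
  by rewrite ler_wpM2l.
by rewrite mulrCA ler_wpM2l ?exprn_ge0 // mulrC; lra.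
Qed.

Lemma part_rapidly_decreasing phi u : schwartz phi -> part_of phi u ->
  rapidly_decreasing u.
Proof.
move=> sp pu; split; first exact: smooth_continuous pu.1.
move=> m; exists (2 ^+ m * (schwartz_seminorm 0 0 phi + schwartz_seminorm (2 * m) 0 phi)).
  by rewrite mulr_ge0 ?exprn_ge0 ?addr_ge0 ?schwartz_seminorm_ge0.
by move=> t; exact: part_decay.
Qed.

Lemma rapidly_decreasing_bounded u : rapidly_decreasing u ->
  exists M, forall x, `|u x| <= M.
Proof. by move=> [_ /(_ 0%N)[C _ h]]; exists C => x; have := h x; rewrite expr0 mulr1. Qed.

(** Multiplication by a complex scalar mixes the two parts of a test function,
    hence the combinations of three functions in the linearity requirement. *)
Lemma tempered_parts (J : (R -> R) -> R) (C : R) (N : nat) :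
  (forall a b u v w, rapidly_decreasing u -> rapidly_decreasing v ->
     rapidly_decreasing w ->
     J (fun x => a * u x + b * v x + w x) = a * J u + b * J v + J w) ->
  (forall phi u, schwartz phi -> part_of phi u ->
     `|J u| <= C * \sum_(m < N) \sum_(n < N) schwartz_seminorm m n phi) ->
  tempered (fun phi => (J (re_part phi) +i* J (im_part phi))%C).
Proof.
move=> Jlin Jb; split; last first.
  exists (2 * C), N => phi sp; rewrite -mulrA.
  by apply: normc_le_add; apply: Jb => //; [exact: re_part_of|exact: im_part_of].
move=> [c1 c2] phi psi sp sq.
have rr := part_rapidly_decreasing sp (re_part_of sp).
have ri := part_rapidly_decreasing sp (im_part_of sp).
have qr := part_rapidly_decreasing sq (re_part_of sq).
have qi := part_rapidly_decreasing sq (im_part_of sq).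
have -> : re_part (fun x => (c1 +i* c2)%C * phi x + psi x) =
    fun x => c1 * re_part phi x + (- c2) * im_part phi x + re_part psi x.
  apply/funext => x; rewrite /re_part /im_part.
  by case: (phi x) => a b; case: (psi x) => c d /=; rewrite mulNr.
have -> : im_part (fun x => (c1 +i* c2)%C * phi x + psi x) =
    fun x => c1 * im_part phi x + c2 * re_part phi x + im_part psi x.
  apply/funext => x; rewrite /re_part /im_part.
  by case: (phi x) => a b; case: (psi x) => c d.
by rewrite !Jlin // mulNr.
Qed.

(** The convolution kernel of the operator acts on a test function through this
    functional of its real and imaginary parts. *)
Definition dual_at0 u : R := levy_apply (levy_dual levy) u 0.

Lemma dual_at0_cvg u M : continuous u -> (forall y, `|u y| <= M) ->
  (fun n => \sum_(k < n) weight k * (u (- site k) - u 0)) @ \oo --> dual_at0 u.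
Proof.
move=> cu uM.
have b k : `|weight k * (u (- site k) - u 0)| <= (2 * M) * 2 ^- k.
  apply: (@weighted_bound _ (fun k => u (- site k) - u 0)) => {}k.
  by rewrite mulr2n mulrDl mul1r; apply: le_trans (ler_normB _ _) _; rewrite lerD.
have /cvg_ex[/= l hl] := geometric_dominated_cvg b.
by rewrite /dual_at0 (levy_apply_dual cu uM hl).
Qed.

Lemma dual_at0_bound u M : continuous u -> (forall y, `|u y| <= M) ->
  `|dual_at0 u| <= 2 * M.
Proof.
move=> cu uM; have h : (fun n => `|\sum_(k < n) weight k * (u (- site k) - u 0)|)
    @ \oo --> `|dual_at0 u| by apply: cvg_norm; exact: dual_at0_cvg cu uM.
have M0 : 0 <= M := le_trans (normr_ge0 _) (uM 0).
rewrite -(cvg_lim _ h) //; apply: limr_le; first by apply/cvg_ex; exists `|dual_at0 u|.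
apply: nearW => n; apply: le_trans (ler_norm_sum _ _ _) _.
apply: (@le_trans _ _ (\sum_(k < n) weight k * (2 * M))).
  apply: ler_sum => k _; rewrite normrM gtr0_norm ?weight_gt0 //.
  rewrite ler_wpM2l ?(ltW (weight_gt0 _)) // mulr2n mulrDl mul1r.
  by apply: le_trans (ler_normB _ _) _; rewrite lerD.
by rewrite -mulr_suml sum_weight ler_piMl ?mulr_ge0 // gerBl invr_ge0 exprn_ge0.
Qed.

Lemma dual_at0_linear a b u v w : rapidly_decreasing u -> rapidly_decreasing v ->
  rapidly_decreasing w ->
  dual_at0 (fun x => a * u x + b * v x + w x)
  = a * dual_at0 u + b * dual_at0 v + dual_at0 w.
Proof.
move=> ru rv rw; have [U hU] := rapidly_decreasing_bounded ru.
have [V hV] := rapidly_decreasing_bounded rv.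
have [W hW] := rapidly_decreasing_bounded rw.
apply: (@levy_apply_dual _ _ (`|a| * U + `|b| * V + W)).
- move=> x; apply: cvgD; last exact: rw.1.
  by apply: cvgD; (apply: cvgM; first exact: cvg_cst); [exact: ru.1|exact: rv.1].
- move=> y; apply: le_trans (ler_normD _ _) _; apply: lerD; last exact: hW.
  by apply: le_trans (ler_normD _ _) _; rewrite !normrM lerD // ler_wpM2l.
- pose S (f : R -> R) (n : nat) : R := \sum_(k < n) weight k * (f (- site k) - f 0).
  have -> : (fun n => \sum_(k < n) weight k *
      (a * u (- site k) + b * v (- site k) + w (- site k) - (a * u 0 + b * v 0 + w 0)))
      = (fun n => a * S u n + b * S v n + S w n).
    apply/funext => n; rewrite /S !mulr_sumr -!big_split /=.
    by apply: eq_bigr => k _; ring.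
  apply: cvgD; last exact: dual_at0_cvg rw.1 hW.
  apply: cvgD; (apply: cvgM; first exact: cvg_cst).
    exact: dual_at0_cvg ru.1 hU.
  exact: dual_at0_cvg rv.1 hV.
Qed.

Lemma levy_kernel_tempered : tempered (levy_kernel (@levy R)).
Proof.
apply: (@tempered_parts dual_at0 2 1); first exact: dual_at0_linear.
move=> phi u sp pu; apply: dual_at0_bound; first exact: smooth_continuous pu.1.
move=> y; rewrite !big_ord1; have := part_seminorm 0 y sp pu.
by rewrite expr0 mul1r.
Qed.

Lemma dual_at0_jump_sum u : rapidly_decreasing u ->
  is_jump_sum u (fun x => dual_at0 (fun y => u (x - y))).
Proof.
move=> ru x; have [U hU] := rapidly_decreasing_bounded ru.
have := dual_at0_cvg (continuous_flip (y := x) ru.1) (fun y => hU (x - y)).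
by under eq_fun do under eq_bigr do rewrite opprK subr0.
Qed.

Lemma of_real_mul_parts (h : R -> R) phi :
  re_part (fun x => of_real h x * phi x) = (fun x => h x * re_part phi x) /\
  im_part (fun x => of_real h x * phi x) = (fun x => h x * im_part phi x).
Proof.
split; apply/funext => x; rewrite /re_part /im_part /of_real;
  case: (phi x) => a b /=.
  by rewrite mul0r subr0.
by rewrite mul0r addr0.
Qed.

Lemma distribution_tempered (h : R -> R) m : balanced m h ->
  tempered (distribution_of (of_real h)).
Proof.
move=> [ch [c c0 hc] _ _].
pose J u := Rintegral mu setT (fun x => h x * u x).
have -> : distribution_of (of_real h) = fun phi => (J (re_part phi) +i* J (im_part phi))%C.
  apply/funext => phi; rewrite /distribution_of /cintegral /J.
  by have [-> ->] := of_real_mul_parts h phi.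
have mJ u : continuous u -> measurable_fun setT (fun x => h x * u x).
  by move=> cu; apply: measurable_funM; exact: continuous_measurable_fun.
have iJ u : rapidly_decreasing u -> mu.-integrable setT (EFin \o (fun x => h x * u x)).
  move=> [cu /(_ m.+1)[C C0 hC]].
  apply: (integrable_dominated (c := c * C) (mJ u cu) _).1 => t.
  rewrite ler_pdivlMr ?oneDsqr_pos // normrM.
  apply: le_trans (_ : c * oneDsqr t ^+ m * `|u t| * oneDsqr t <= _).
    by rewrite ler_wpM2r ?oneDsqr_nneg // ler_wpM2r.
  have -> : c * oneDsqr t ^+ m * `|u t| * oneDsqr t = c * (`|u t| * oneDsqr t ^+ m.+1).
    by rewrite exprSr; ring.
  by rewrite ler_wpM2l.
pose N := (2 * m.+1).+1.
apply: (@tempered_parts J (c * (2 ^+ m.+1 * 2) * integral_oneDsqrV) N).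
  move=> a b u v w ru rv rw; rewrite /J.
  have zi d f : rapidly_decreasing f ->
      mu.-integrable setT (EFin \o (fun x => d * (h x * f x))).
    move=> rf; have := integrableZl measurableT d (iJ f rf).
    by [].
  rewrite -(RintegralZl a measurableT (iJ u ru)) -(RintegralZl b measurableT (iJ v rv)).
  rewrite -RintegralD //; [|exact: zi|exact: zi].
  rewrite -RintegralD //; last exact: iJ.
    by apply: eq_Rintegral => x _; ring.
  have := integrableD measurableT (zi a u ru) (zi b v rv).
  by [].
move=> phi u sp pu; set S := \sum_(_ < N) _.
have le0 := schwartz_seminorm_le_sum sp (isT : (0 < N)%N) (isT : (0 < N)%N).
have le2 := schwartz_seminorm_le_sum sp (ltnSn _ : (2 * m.+1 < N)%N) (isT : (0 < N)%N).
have cu := smooth_continuous pu.1; rewrite -/S in le0 le2.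
rewrite mulrAC; apply: Rintegral_bound (mJ u cu) _ => t.
rewrite ler_pdivlMr ?oneDsqr_pos // normrM.
apply: le_trans (_ : c * oneDsqr t ^+ m * `|u t| * oneDsqr t <= _).
  by rewrite ler_wpM2r ?oneDsqr_nneg // ler_wpM2r.
have -> : c * oneDsqr t ^+ m * `|u t| * oneDsqr t = c * (`|u t| * oneDsqr t ^+ m.+1).
  by rewrite exprSr; ring.
rewrite -!mulrA ler_wpM2l //; apply: le_trans (part_decay m.+1 t sp pu) _.
by rewrite ler_wpM2l ?exprn_ge0 //; lra.
Qed.

(** Both parts of [levy_kernel levy * phi] are jump sums and both parts of
    [h * psi] are balanced, so each of the four real products integrates to
    zero. *)
Lemma balanced_Sprime_convolution (h : R -> R) m : balanced m h ->
  is_Sprime_convolution (levy_kernel (@levy R)) (distribution_of (of_real h))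
    (fun _ => 0).
Proof.
move=> bh; split.
- exact: levy_kernel_tempered.
- exact: distribution_tempered bh.
- split; first by move=> c phi psi _ _; rewrite mulr0 addr0.
  exists 0, 0%N => phi _; rewrite mul0r.
  by rewrite [X in X <= _]ComplexField.Normc.normc0.
move=> phi psi sp sq x.
pose K (u : R -> R) (x : R) := dual_at0 (fun y => u (x - y)).
have e : dconvolution (distribution_of (of_real h)) psi =
    fun y => (rconv h (re_part psi) y +i* rconv h (im_part psi) y)%C.
  apply/funext => y; rewrite /dconvolution /distribution_of /cintegral /rconv.
  by have [-> ->] := of_real_mul_parts h (fun t => psi (y - t)).
have ek : dconvolution (levy_kernel (@levy R)) phi =
    fun y => (K (re_part phi) y +i* K (im_part phi) y)%C by [].
have pr := part_rapidly_decreasing sp (re_part_of sp).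
have pi := part_rapidly_decreasing sp (im_part_of sp).
have br := balanced_rconv bh (part_rapidly_decreasing sq (re_part_of sq)).
have bi := balanced_rconv bh (part_rapidly_decreasing sq (im_part_of sq)).
have [irr zrr] := jump_convolution x br pr (dual_at0_jump_sum pr).
have [iri zri] := jump_convolution x bi pr (dual_at0_jump_sum pr).
have [iir zir] := jump_convolution x br pi (dual_at0_jump_sum pi).
have [iii zii] := jump_convolution x bi pi (dual_at0_jump_sum pi).
rewrite /convolvable /convolution /cintegrable /cintegral ek e.
pose a y := K (re_part phi) (x - y) * rconv h (re_part psi) y.
pose b y := K (im_part phi) (x - y) * rconv h (im_part psi) y.
pose c y := K (re_part phi) (x - y) * rconv h (im_part psi) y.
pose d y := K (im_part phi) (x - y) * rconv h (re_part psi) y.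
rewrite -[re_part _]/(fun y => a y - b y) -[im_part _]/(fun y => c y + d y).
split; first split.
- exact: (integrableB measurableT irr iii).
- exact: (integrableD measurableT iri iir).
have -> : Rintegral mu setT (fun y => a y - b y) = 0.
  rewrite (RintegralB measurableT irr iii).
  by move: zrr zii; rewrite -/a -/b => -> ->; rewrite subrr.
have -> : Rintegral mu setT (fun y => c y + d y) = 0.
  rewrite (RintegralD measurableT iri iir).
  by move: zri zir; rewrite -/c -/d => -> ->; rewrite addr0.
by [].
Qed.

End Schwartz.

Theorem theorem4p1 (R : realType) :
  exists (L : levy_operator R) (h : R -> R),
    smooth h /\
    not_concentrated_on_proper_closed_subgroup L /\
    (forall eps : R, 0 < eps ->
       (`|x| `^ (- eps) * h x @[x --> +oo] --> (0 : R)) /\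
       (`|x| `^ (- eps) * h x @[x --> -oo] --> (0 : R))) /\
    (forall x : R,
       (levy_nu L).-integrable [set~ 0] (EFin \o levy_integrand h x) /\
       levy_apply L h x = 0) /\
    is_Sprime_convolution (levy_kernel L) (distribution_of (of_real h))
      (fun _ => 0) /\
    ~ (exists p : {poly R}, forall x : R, h x = p.[x]).
Proof.
exists levy, (harmonic bump); split; first exact: harmonic_bump_smooth.
split; first exact: levy_not_concentrated.
split; first exact: harmonic_subpower.
split; first by move=> x; exact: levy_apply_balanced x harmonic_balanced.
split; first exact: balanced_Sprime_convolution harmonic_balanced.
exact: harmonic_not_polynomial.
Qed.
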